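(* Let $t\ge d\ge2$ be integers and let $(\gamma_t,w_t)$ be a weighted Marcinkiewicz–Zygmund curve of order $t$ on $\mathbb S^d$ with constants $0<a\le A$. Then its length satisfies \[ \ell(\gamma_t)\ge \frac{\dim\Pi_t}{t}\,\frac{\sqrt{d+2}}{4}\Big(\frac aA\Big)^{1+\frac1{2t}} . \]
   Context: $\mathbb S^d\subset\mathbb R^{d+1}$ is the unit sphere with normalized surface measure (total mass $1$), and $L^2$ norms are with respect to it. $\Pi_t$ is the space of restrictions to $\mathbb S^d$ of polynomials in $d+1$ variables of degree at most $t$, $\dim\Pi_t=\binom{d+t}{t}+\binom{d+t-1}{t-1}$. A curve is a continuous, piecewise smooth, closed map $\gamma:[0,L]\to\mathbb S^d$ ($\gamma(0)=\gamma(L)$) parametrized by arc length ($\|\dot\gamma\|=1$ a.e.), so its length is $\ell(\gamma)=L$ and $\int_\gamma g:=\int_0^L g(\gamma(u))\,du$. A weighted Marcinkiewicz–Zygmund curve of order $t$ is a pair $(\gamma_t,w_t)$ of such a curve and a nonnegative weight $w_t$ defined and integrable on the trajectory of $\gamma_t$ such that for all $f\in\Pi_t$, \[ a\|f\|_{L^2(\mathbb S^d)}^2\le\frac1{\ell(\gamma_t)}\int_{\gamma_t}|f|^2w_t\le A\|f\|_{L^2(\mathbb S^d)}^2 . \] *)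

(* Defs.v *)
From HB Require Import structures.
From mathcomp Require Import all_boot all_order all_algebra.
From mathcomp Require Import all_classical all_reals all_analysis.
Set Implicit Arguments. Unset Strict Implicit. Unset Printing Implicit Defensive.
Import Order.TTheory GRing.Theory Num.Theory.
Import numFieldNormedType.Exports.
Local Open Scope classical_set_scope.
Local Open Scope ring_scope.

Section Defs.
Variable R : realType.

Definition pt (n : nat) := 'I_n -> R.

Definition enorm (n : nat) (x : pt n) : R := Num.sqrt (\sum_(i < n) x i ^+ 2).

Definition vcons (n : nat) (s : R) (v : pt n) : pt n.+1 :=
  fun i => match unlift ord0 i with None => s | Some j => v j end.

Fixpoint cube_int (n : nat) : (pt n -> R) -> R :=
  match n return (pt n -> R) -> R with
  | 0 => fun F => F (fun i => 0)
  | n'.+1 => fun F =>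
      Rintegral lebesgue_measure `[-1, 1]
        (fun s : R => cube_int (fun v : pt n' => F (vcons s v)))
  end.

(* Integral w.r.t. the normalized surface measure on S^d (subset of R^(d+1)),
   defined as the cone measure:  int_{S^d} g dsigma
     = (1/vol(B)) int_{B \ 0} g(x/|x|) dx,  B the closed unit ball. *)
Definition sphere_int (d : nat) (g : pt d.+1 -> R) : R :=
  cube_int (fun x => if (0 < enorm x) && (enorm x <= 1)
                      then g (fun i => x i / enorm x) else 0)
  / cube_int (fun x : pt d.+1 => if enorm x <= 1 then 1 else 0).

Definition L2sq (d : nat) (f : pt d.+1 -> R) : R := sphere_int (fun x => f x ^+ 2).

Definition in_Pi (d t : nat) (f : pt d.+1 -> R) : Prop :=
  exists c : {ffun {ffun 'I_d.+1 -> 'I_t.+1} -> R},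
    forall x : pt d.+1,
      f x = \sum_(al : {ffun 'I_d.+1 -> 'I_t.+1} | (\sum_i (al i : nat) <= t)%N)
              c al * \prod_(i < d.+1) x i ^+ al i.

Definition on_sphere (d : nat) (x : pt d.+1) : Prop := enorm x = 1.

Definition C1_on (g : R -> R) (a b : R) : Prop :=
  (forall u, u \in `]a, b[ -> derivable g u 1) /\
  exists h : R -> R, {within `[a, b], continuous h} /\
    forall u, u \in `]a, b[ -> h u = derive1 g u.

Definition arclength_curve (d : nat) (gam : R -> pt d.+1) (L : R) : Prop :=
  0 < L /\
  (forall u, u \in `[0, L] -> on_sphere (gam u)) /\
  gam 0 = gam L /\
  (forall i, {within `[0, L], continuous (fun u => gam u i)}) /\
  exists s : seq R,
    let P := 0 :: rcons s L in
    sorted <%R P /\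
    forall ab, ab \in zip P (behead P) ->
      (forall i, C1_on (fun u => gam u i) ab.1 ab.2) /\
      (forall u, u \in `]ab.1, ab.2[ ->
         \sum_(i < d.+1) (derive1 (fun v => gam v i) u) ^+ 2 = 1).

Definition curve_int (d : nat) (gam : R -> pt d.+1) (L : R) (g : pt d.+1 -> R) : R :=
  Rintegral lebesgue_measure `[0, L] (fun u => g (gam u)).

Definition wMZ_curve (d t : nat) (gam : R -> pt d.+1) (L : R)
    (w : pt d.+1 -> R) (a A : R) : Prop :=
  arclength_curve gam L /\
  (forall u, u \in `[0, L] -> 0 <= w (gam u)) /\
  lebesgue_measure.-integrable `[0, L] (fun u => (w (gam u))%:E) /\
  forall f, @in_Pi d t f ->
    a * L2sq f <= L^-1 * curve_int gam L (fun x => f x ^+ 2 * w x) /\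
    L^-1 * curve_int gam L (fun x => f x ^+ 2 * w x) <= A * L2sq f.

Definition dimPi (d t : nat) : nat := ('C(d + t, t) + 'C(d + t - 1, t - 1))%N.

End Defs.

(* Main.v *)
Require Import Defs.
From HB Require Import structures.
From mathcomp Require Import all_boot all_order all_algebra.
From mathcomp Require Import all_classical all_reals all_analysis measurable_realfun.
From mathcomp Require Import ring lra zify.
From mathcomp Require Import -(notations) mpoly.
Import Order.TTheory GRing.Theory Num.Theory.
Import numFieldNormedType.Exports.
Local Open Scope classical_set_scope.
Local Open Scope ring_scope.

(* Write N for the dimension of Pi_t and K for its reproducing kernel with respect to
   the normalised surface measure.  Rotation invariance makes K zonal,
   K(x,y) = P(<x,y>) on the sphere, with P(1) = N.  The trace of the sum of the squared
   rotation generators x_i d_j - x_j d_i, evaluated in the monomial basis, equals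
   -2 d P'(1) and yields P'(1) <= N (t^2 + (d-1) t) / d.  Since
   N - K(x,y) = |K_x - K_y|^2 / 2, adding up small steps along the curve gives
     K(gam u, gam v) >= N (1 - (t^2/d) (u-v)^2).
   Testing the upper Marcinkiewicz-Zygmund inequality on the kernels K_x at m equally
   spaced points of the curve, and the lower one on the constant 1, yields with
   z = t L / (2 m sqrt d) <= 1 the estimate m >= (a/A) N (1 - z^2)^2.  If t L / sqrt d
   is not small, a suitable m finishes the proof.  Otherwise m = 1 bounds (a/A) N by an
   absolute constant, and f(x) = <e,x>^t with e orthogonal to gam (L/2) satisfies
   |f| <= (L/2)^t on the curve and |f|^2 >= (d+1)^-t in the mean, whence the factor
   (a/A)^(1/(2t)). *)

(** [sphere_int] is built from iterated one-dimensional integrals, in which rotations are invisible.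
    Invariance and definiteness of the mean are both drawn from a moment recursion, an integration
    by parts on the sphere: for [p] homogeneous of degree [k], [(d + k)] times the mean of [x_i p]
    is the mean of [d_i p]. The rotated mean obeys the same recursion, hence invariance; null
    polynomials have null derivatives, hence definiteness on two consecutive degrees. The trace is
    read off exponents of monomials, without spherical harmonics; [t^2 + (d-1) t] is the Laplace
    eigenvalue of the top degree. Expanding P at 1 controls K only near the diagonal. The Hilbert
    norm |K_x - K_y| lets such local bounds add up along the curve, and refining the steps shrinks
    the quadratic remainder until it fits into the gap between [t^2 + (d-1) t] and [2 t^2], which is
    positive because [t >= d]. *)

Set Implicit Arguments. Unset Strict Implicit. Unset Printing Implicit Defensive.

(** * Iterated integrals over the cube *)

Section CubeIntegral.
Variable R : realType.
Local Notation mu := (@lebesgue_measure R).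
Local Notation I11 := (`[(-1 : R), 1]%classic).

(* [Rintegral] of a non-integrable function is a junk value, so the calculus of
   [cube_int] is developed on the functions all of whose iterated integrals exist. *)
Fixpoint iter_integrable (n : nat) : (pt R n -> R) -> Prop :=
  match n return (pt R n -> R) -> Prop with
  | 0 => fun _ => True
  | n'.+1 => fun F =>
      (forall s, iter_integrable (fun v => F (vcons s v))) /\
      mu.-integrable I11 (EFin \o (fun s => cube_int (fun v : pt R n' => F (vcons s v))))
  end.

Lemma measurable_I11 : measurable (I11 : set (measurableTypeR R)).
Proof. exact: measurable_itv. Qed.

Lemma integrable_cst_itv a b (c : R) : mu.-integrable `[a, b]%classic (EFin \o cst c).
Proof.
apply: continuous_compact_integrable; first exact: segment_compact.
by move=> x; exact: cvg_cst.
Qed.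

Lemma cube_intD n (F G : pt R n -> R) : iter_integrable F -> iter_integrable G ->
  iter_integrable (fun x => F x + G x) /\
  cube_int (fun x => F x + G x) = cube_int F + cube_int G.
Proof.
elim: n F G => [|n IH] F G //= [gF iF] [gG iG].
have sliceD s : cube_int (fun v => F (vcons s v) + G (vcons s v)) =
    cube_int (fun v => F (vcons s v)) + cube_int (fun v => G (vcons s v)).
  by case: (IH _ _ (gF s) (gG s)).
split; last by under eq_Rintegral do rewrite sliceD; rewrite RintegralD.
split=> [s|]; first by case: (IH _ _ (gF s) (gG s)).
rewrite (_ : EFin \o _ = ((EFin \o (fun s => cube_int (fun v => F (vcons s v)))) \+
  (EFin \o (fun s => cube_int (fun v => G (vcons s v)))))%E); first exact: integrableD.
by apply/funext => s /=; rewrite sliceD EFinD.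
Qed.

Lemma cube_intZ n c (F : pt R n -> R) : iter_integrable F ->
  iter_integrable (fun x => c * F x) /\ cube_int (fun x => c * F x) = c * cube_int F.
Proof.
elim: n F => [|n IH] F //= [gF iF].
have sliceZ s : cube_int (fun v => c * F (vcons s v)) =
    c * cube_int (fun v => F (vcons s v)).
  by case: (IH _ (gF s)).
split; last by under eq_Rintegral do rewrite sliceZ; rewrite RintegralZl.
split=> [s|]; first by case: (IH _ (gF s)).
rewrite (_ : EFin \o _ =
  (fun s => c%:E * (EFin \o (fun s => cube_int (fun v => F (vcons s v)))) s)%E).
  exact: integrableZl.
by apply/funext => s /=; rewrite sliceZ EFinM.
Qed.

Lemma cube_int0 n : iter_integrable (fun _ : pt R n => 0) /\ cube_int (fun _ : pt R n => 0) = 0.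
Proof.
elim: n => [|n [IH1 IH2]] //=.
split; last by under eq_Rintegral do rewrite IH2; rewrite Rintegral_cst// mul0r.
split=> [//|].
rewrite (_ : EFin \o _ = cst 0%E); first exact: integrable0.
by apply/funext => s /=; rewrite IH2.
Qed.

Lemma cube_int_sum n (J : Type) (r : seq J) (c : J -> R) (F : J -> pt R n -> R) :
  (forall j, iter_integrable (F j)) ->
  iter_integrable (fun x => \sum_(j <- r) c j * F j x) /\
  cube_int (fun x => \sum_(j <- r) c j * F j x) = \sum_(j <- r) c j * cube_int (F j).
Proof.
move=> gF; elim: r => [|j r [IH1 IH2]].
  rewrite big_nil (_ : (fun _ => _) = (fun _ => 0)); first exact: cube_int0.
  by apply/funext => x; rewrite big_nil.
rewrite big_cons (_ : (fun _ => _) =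
  (fun x => c j * F j x + \sum_(j <- r) c j * F j x)); last first.
  by apply/funext => x; rewrite big_cons.
have [gj ij] := cube_intZ (c j) (gF j).
by have [? ->] := cube_intD gj IH1; rewrite ij IH2.
Qed.

Lemma cube_int_ge0 n (F : pt R n -> R) : (forall x, 0 <= F x) -> 0 <= cube_int F.
Proof.
elim: n F => [|n IH] F F0 //=.
by apply: Rintegral_ge0 => s _; apply: IH.
Qed.

Lemma fine_mu_I11 : fine (mu I11) = 2.
Proof.
have h : (-1 : R) < 1 by lra.
by rewrite lebesgue_measure_itv/= lte_fin h/= opprK.
Qed.

Lemma cube_int_bounded n (F : pt R n -> R) (C : R) : iter_integrable F -> (forall x, `|F x| <= C) ->
  `|cube_int F| <= C * 2 ^+ n.
Proof.
elim: n F => [|n IH] F /=; first by move=> _ /(_ (fun=> 0)); rewrite expr0 mulr1.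
move=> [gF iF] bF.
apply: (le_trans (le_normr_Rintegral measurable_I11 iF)).
rewrite exprSr mulrA -[X in _ <= _ * X]fine_mu_I11 -Rintegral_cst//.
apply: le_Rintegral => //.
- have := integrable_abse iF; apply: eq_integrable => //.
- exact: integrable_cst_itv.
- move=> s _; exact: (IH _ (gF s) (fun x => bF _)).
Qed.

(* Dominated convergence, one coordinate at a time. *)
Lemma cube_int_cvg n (F : nat -> pt R n -> R) (G : pt R n -> R) (C : R) :
  (forall m, iter_integrable (F m)) -> (forall m x, `|F m x| <= C) ->
  (forall x, (fun m => F m x) @ \oo --> G x) ->
  iter_integrable G /\ (fun m => cube_int (F m)) @ \oo --> cube_int G.
Proof.
elim: n F G => [|n IH] F G gF bF FG.
  by split=> //=; apply: FG.
have IHs s : iter_integrable (fun v => G (vcons s v)) /\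
    (fun m => cube_int (fun v => F m (vcons s v))) @ \oo -->
      cube_int (fun v => G (vcons s v)).
  apply: IH => [m|m x|x]; [by case: (gF m) => gs _; exact: gs|exact: bF|exact: FG].
have bs m s : `|cube_int (fun v => F m (vcons s v))| <= C * 2 ^+ n.
  by apply: cube_int_bounded => [|x]; [case: (gF m) => gs _; exact: gs|exact: bF].
have [|||||] := @dominated_convergence _ _ _ mu I11 measurable_I11
  (fun m s => (cube_int (fun v => F m (vcons s v)))%:E)
  (fun s => (cube_int (fun v => G (vcons s v)))%:E) (cst (C * 2 ^+ n)%:E).
- by move=> m; case: (gF m) => _ /integrableP[].
- apply/measurable_EFinP.
  apply: (@measurable_fun_cvg _ _ _ _
    (fun m s => cube_int (fun v => F m (vcons s v)))).
    by move=> m; case: (gF m) => _ /integrableP[] /measurable_EFinP.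
  by move=> s _; case: (IHs s).
- by apply: aeW => s _; apply: cvg_EFin; [exact: nearW|case: (IHs s)].
- exact: integrable_cst_itv.
- by apply: aeW => s m _ /=; rewrite lee_fin.
move=> iG _ cG; split=> /=; first by split=> // s; case: (IHs s).
apply: fine_cvg; rewrite fineK//; exact: integrable_fin_num.
Qed.

Lemma eq_cube_int n (F G : pt R n -> R) : F =1 G -> cube_int F = cube_int G.
Proof. by move=> FG; congr cube_int; apply/funext. Qed.

End CubeIntegral.

(** * Beta integrals *)

Section BetaIntegral.
Variable R : realType.
Local Notation mu := (@lebesgue_measure R).

(** At height [s] the ball of radius [r] has a slice of radius [sqrt (r^2 - s^2)]. A monomial of
    degree [k] in the [n] other variables integrates over it to a constant times the [(n + k)]-th
    power of that radius: [m] stands for [n + k], and [a] for the exponent of [s]. *)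
Definition bker (r : R) (a m : nat) (s : R) : R := s ^+ a * Num.sqrt (r ^+ 2 - s ^+ 2) ^+ m.

(** For even [a] this is the Beta function at [(a+1)/2] and [m/2 + 1]; it is handled through
    recursions in steps of two. *)
Definition beta (a m : nat) : R := Rintegral mu `[-1, 1]%classic (bker 1 a m).

Lemma continuous_bker r a m : continuous (bker r a m).
Proof.
move=> s; apply: (@continuousM _ _ (fun s : R => s ^+ a)
  (fun s : R => Num.sqrt (r ^+ 2 - s ^+ 2) ^+ m)); first exact: exprn_continuous.
apply: (@continuous_comp _ _ _ (fun s : R => Num.sqrt (r ^+ 2 - s ^+ 2)) (fun y : R => y ^+ m)).
  apply: (@continuous_comp _ _ _ (fun s : R => r ^+ 2 - s ^+ 2) Num.sqrt).
    by apply: continuousB; [exact: cst_continuous|exact: exprn_continuous].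
  exact: sqrt_continuous.
exact: exprn_continuous.
Qed.

Lemma integrable_continuous_itv (f : R -> R) (x y : R) : continuous f ->
  mu.-integrable `[x, y]%classic (EFin \o f).
Proof.
move=> cf; apply: continuous_compact_integrable; first exact: segment_compact.
exact: continuous_subspaceT.
Qed.

Lemma betaS2r a m : beta a m.+2 = beta a m - beta a.+2 m.
Proof.
rewrite -RintegralB//; [|exact/integrable_continuous_itv/continuous_bker..].
apply: eq_Rintegral => s; rewrite inE/= in_itv/= => /andP[s1 s2].
have q : Num.sqrt (1 ^+ 2 - s ^+ 2) ^+ 2 = 1 - s ^+ 2.
  by rewrite sqr_sqrtr expr1n//; nra.
by rewrite /bker [X in _ * X](exprD _ 2 m) q !exprS; ring.
Qed.

(** Integrate the derivative of [s^(a+1) (1 - s^2)^((m+2)/2)], which vanishes at both ends. The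
    square root is differentiated only inside the interval; at the ends continuity suffices. *)
Lemma beta_by_parts a m : (a.+1)%:R * beta a m.+2 = (m.+2)%:R * beta a.+2 m.
Proof.
pose f s := (a.+1)%:R * bker 1 a m.+2 s - (m.+2)%:R * bker 1 a.+2 m s.
have ib k l : mu.-integrable `[-1, 1]%classic (EFin \o bker 1 k l).
  exact/integrable_continuous_itv/continuous_bker.
have iZ c k l : mu.-integrable `[-1, 1]%classic (EFin \o (fun s => c * bker 1 k l s)).
  apply: integrable_continuous_itv => s; apply: continuousM; first exact: cst_continuous.
  exact: continuous_bker.
have dG (s : R) : -1 < s < 1 -> is_derive s 1 (bker 1 a.+1 m.+2) (f s).
  move=> /andP[s1 s2].
  have pos : 0 < 1 ^+ 2 - s ^+ 2 by rewrite expr1n; nra.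
  have dq : is_derive s 1 (fun s : R => 1 ^+ 2 - s ^+ 2) (- (2 * s)).
    by apply: is_derive_eq; rewrite /GRing.scale/=; ring.
  have dsq := is_derive1_sqrt pos.
  have dc : is_derive s 1 (fun s : R => Num.sqrt (1 ^+ 2 - s ^+ 2))
      (- s / Num.sqrt (1 ^+ 2 - s ^+ 2)).
    apply: is_derive_eq; field.
    by rewrite gt_eqF// sqrtr_gt0.
  have eM : bker 1 a.+1 m.+2 =
      (id ^+ a.+1 : R -> R) * (fun s : R => Num.sqrt (1 ^+ 2 - s ^+ 2)) ^+ m.+2.
    by apply/funext => y; rewrite /bker !fctE.
  rewrite eM; apply: is_derive_eq; rewrite /f /bker /GRing.scale !fctE/= mulr1.
  set q := Num.sqrt _ in pos dc *; have q0 : q != 0 by rewrite gt_eqF// sqrtr_gt0.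
  rewrite (exprS q m.+1) (exprS q m) (exprS s a.+1) (exprS s a); field.
  exact: q0.
have : Rintegral mu `[-1, 1]%classic f = 0.
  rewrite /Rintegral (@continuous_FTC2 _ _ (bker 1 a.+1 m.+2)).
  - by rewrite /bker !expr1n sqrrN expr1n subrr sqrtr0 expr0n/= !mulr0 subrr.
  - lra.
  - apply: continuous_subspaceT => x.
    apply: (@continuousB _ _ _ (fun s => a.+1%:R * bker 1 a m.+2 s)
      (fun s => m.+2%:R * bker 1 a.+2 m s));
    by apply: continuousM; [exact: cst_continuous|exact: continuous_bker].
  - split=> [s|  | ].
    + by rewrite in_itv/= => s1; case: (dG s s1).
    + apply: cvg_at_right_filter; exact: continuous_bker.
    + apply: cvg_at_left_filter; exact: continuous_bker.
  - move=> s; rewrite in_itv/= => s1; rewrite derive1E.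
    by case: (dG s s1).
rewrite RintegralB// !RintegralZl// => /eqP; rewrite subr_eq0 => /eqP; exact.
Qed.

Lemma betaS2l a m : (a + m + 3)%:R * beta a.+2 m = (a.+1)%:R * beta a m.
Proof.
have := beta_by_parts a m; rewrite betaS2r mulrBr => /eqP.
rewrite subr_eq -mulrDl -natrD => /eqP ->; congr (_%:R * _); lia.
Qed.

Lemma betaS2r' a m : (a + m + 3)%:R * beta a m.+2 = (m.+2)%:R * beta a m.
Proof.
rewrite betaS2r mulrBr betaS2l -mulrBl; congr (_ * _).
by rewrite -natrB; [congr _%:R; lia|lia].
Qed.

Lemma beta_odd a m : odd a -> beta a m = 0.
Proof.
move=> oa; suff : beta a m = - beta a m by lra.
rewrite {1}/beta /Rintegral.
have := @integration_by_substitution_oppr R (bker 1 a m) (-1) 1; rewrite opprK => ->.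
- rewrite -[RHS]mulN1r /beta -RintegralZl//; last exact/integrable_continuous_itv/continuous_bker.
  congr fine; apply: eq_integral => s _ /=; congr EFin.
  by rewrite /bker sqrrN exprNn -signr_odd oa expr1 mulrA.
- lra.
- exact/continuous_subspaceT/continuous_bker.
Qed.

Lemma bker_scale a m r : 0 <= r -> r <= 1 ->
  Rintegral mu `[-1, 1]%classic (fun s => if s ^+ 2 <= r ^+ 2 then bker r a m s else 0)
    = r ^+ (a + m + 1) * beta a m.
Proof.
move=> r0 r1.
transitivity (Rintegral mu `[-r, r]%classic (bker r a m)).
  rewrite (_ : `[-r, r]%classic = `[-1, 1]%classic `&` `[-r, r]%classic); last first.
    apply/seteqP; split=> s /=; last by case.
    by rewrite !in_itv/= => /andP[? ?]; split; [|apply/andP]; lra.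
  rewrite Rintegral_mkcondr; apply: eq_Rintegral => s _; rewrite patchE.
  suff -> : (s \in `[-r, r]%classic) = (s ^+ 2 <= r ^+ 2) by [].
  rewrite mem_setE in_itv/= -ler_norml -{1}(ger0_norm r0).
  by rewrite -[in RHS](real_normK (num_real s)) -[in RHS](real_normK (num_real r)) ler_sqr ?nnegrE.
(* The substitution [s = r * s'] must be increasing. For [r = 0] the interval is a point, and the
   positive exponent [a + m + 1] makes the right side 0. *)
have [->|rn0] := eqVneq r 0.
  by rewrite oppr0 set_itv1 Rintegral_set1 addn1 expr0n mul0r.
have rp : 0 < r by rewrite lt_def rn0.
rewrite /Rintegral.
have -> : `[-r, r]%classic = `[r * -1, r * 1]%classic by rewrite mulrN1 mulr1.
have dF : derive1 (fun x : R => r * x) = cst r.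
  apply/funext => x; rewrite derive1E /cst.
  have [_ ->] : is_derive x 1 (fun x : R => r * x) r; last by [].
  by apply: is_derive_eq; rewrite /GRing.scale/= mulr1.
rewrite (@integration_by_substitution_increasing _ (fun x => r * x)).
- rewrite /beta -RintegralZl//; last exact/integrable_continuous_itv/continuous_bker.
  congr fine; apply: eq_integral => s _ /=; congr EFin.
  rewrite dF /bker expr1n !fctE /=.
  have -> : r ^+ 2 - (r * s) ^+ 2 = r ^+ 2 * (1 - s ^+ 2) by ring.
  rewrite sqrtrM ?sqr_ge0// sqrtr_sqr ger0_norm// !exprMn !exprD expr1; ring.
- lra.
- by move=> x y _ _; rewrite ltr_pM2l.
- by rewrite dF => x _; exact: cvg_cst.
- by rewrite dF; exact: is_cvg_cst.
- by rewrite dF; exact: is_cvg_cst.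
- have cF : continuous (fun x : R => r * x).
    by move=> x; apply: continuousM; [exact: cst_continuous|exact: cvg_id].
  split=> [x _||]; first by apply: derivableM.
    exact/cvg_at_right_filter/cF.
  exact/cvg_at_left_filter/cF.
- exact/continuous_subspaceT/continuous_bker.
Qed.

Lemma beta00 : beta 0 0 = 2.
Proof.
rewrite /beta (_ : bker 1 0 0 = cst 1); first by rewrite Rintegral_cst// fine_mu_I11 mul1r.
by apply/funext => s; rewrite /bker !expr0 mulr1.
Qed.

Lemma beta0_gt0 m : 0 < beta 0 m.
Proof.
have step k : 0 < beta 0 k -> 0 < beta 0 k.+2.
  have k3 : 0 < (0 + k + 3)%:R :> R by rewrite ltr0n; lia.
  by move=> bk; rewrite -(pmulr_rgt0 _ k3) betaS2r' mulr_gt0.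
have b0 : 0 < beta 0 0 by rewrite beta00.
(* The second base case of the induction by twos: [q^2 <= q] for [q = sqrt (1 - s^2)] in [[0, 1]],
   so [beta 0 1] dominates [beta 0 2]. *)
have b1 : 0 < beta 0 1.
  apply: (lt_le_trans (step _ b0)); apply: le_Rintegral => //.
  - exact/integrable_continuous_itv/continuous_bker.
  - exact/integrable_continuous_itv/continuous_bker.
  - move=> s; rewrite /= in_itv/= => /andP[s1 s2].
    rewrite /bker !expr0 !mul1r expr1 expr2 ler_piMl ?sqrtr_ge0//.
    by rewrite -[leRHS]sqrtr1 ler_sqrt// expr1n; nra.
suff [] : 0 < beta 0 m /\ 0 < beta 0 m.+1 by [].
by elim: m => [//|m [IH1 IH2]]; split=> //; exact: step.
Qed.

End BetaIntegral.

(** * Moments of the ball and of the sphere *)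

Section SphereMoments.
Variable R : realType.
Local Notation mu := (@lebesgue_measure R).

Definition nsq n (x : pt R n) : R := \sum_i x i ^+ 2.

Definition mono n (al : 'I_n -> nat) (x : pt R n) : R := \prod_i x i ^+ al i.

Definition incr2 n (i : 'I_n) (al : 'I_n -> nat) : 'I_n -> nat :=
  fun j => (al j + (i == j).*2)%N.

Definition ball_mono n (r : R) (al : 'I_n -> nat) (x : pt R n) : R :=
  if nsq x <= r ^+ 2 then mono al x else 0.

(** The moment over the unit ball as the product of Beta values that slicing produces; the second
    argument of [beta] counts the remaining dimensions and the degree left to them. *)
Fixpoint ball_mom n : ('I_n -> nat) -> R :=
  match n return ('I_n -> nat) -> R with
  | 0 => fun _ => 1
  | n'.+1 => fun al =>
      beta R (al ord0) (n' + \sum_(i < n') al (lift ord0 i)) * ball_mom (fun i => al (lift ord0 i))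
  end.

Lemma nsq_ge0 n (x : pt R n) : 0 <= nsq x.
Proof. by apply: sumr_ge0 => i _; exact: sqr_ge0. Qed.

Lemma vcons0 n s (v : pt R n) : vcons s v ord0 = s.
Proof. by rewrite /vcons unlift_none. Qed.

Lemma vconsS n s (v : pt R n) i : vcons s v (lift ord0 i) = v i.
Proof. by rewrite /vcons liftK. Qed.

Lemma nsq_vcons n s (v : pt R n) : nsq (vcons s v) = s ^+ 2 + nsq v.
Proof.
rewrite /nsq big_ord_recl vcons0; congr (_ + _).
by apply: eq_bigr => i _; rewrite vconsS.
Qed.

Lemma mono_vcons n al s (v : pt R n) :
  mono al (vcons s v) = s ^+ al ord0 * mono (fun i => al (lift ord0 i)) v.
Proof.
rewrite /mono big_ord_recl vcons0; congr (_ * _).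
by apply: eq_bigr => i _; rewrite vconsS.
Qed.

Lemma ball_mono_vcons n r al s (v : pt R n) :
  ball_mono r al (vcons s v) =
  if s ^+ 2 <= r ^+ 2 then
    s ^+ al ord0 * ball_mono (Num.sqrt (r ^+ 2 - s ^+ 2)) (fun i => al (lift ord0 i)) v
  else 0.
Proof.
rewrite /ball_mono nsq_vcons mono_vcons; case: ifPn => sr; case: ifPn => // h.
- by rewrite sqr_sqrtr ?subr_ge0// ifT// lerBrDl.
- have := nsq_ge0 v; lra.
- by rewrite sqr_sqrtr ?subr_ge0// ifF ?mulr0// lerBrDl; exact/negbTE.
Qed.

Lemma integrable_bker r a m :
  mu.-integrable `[-1, 1]%classic
    (EFin \o (fun s => if s ^+ 2 <= r ^+ 2 then bker r a m s else 0)).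
Proof.
have ic : mu.-integrable `[-1, 1]%classic (EFin \o bker r a m).
  exact/integrable_continuous_itv/continuous_bker.
apply: le_integrable ic => //.
- apply/measurable_EFinP/measurable_funTS; apply: measurable_fun_ifT => //.
  + by apply: measurable_fun_ler => //; exact: exprn_measurable.
  + by apply: continuous_measurable_fun; exact: continuous_bker.
- by move=> s _ /=; case: ifP => // _; rewrite normr0 lee_fin.
Qed.

(** The radius is general because slices of the unit ball have smaller radii; [r <= 1] keeps the
    ball inside the cube of integration. *)
Lemma ball_moment n (al : 'I_n -> nat) r : 0 <= r -> r <= 1 ->
  iter_integrable (ball_mono r al) /\
  cube_int (ball_mono r al) = r ^+ (n + \sum_i al i) * ball_mom al.
Proof.
elim: n al r => [|n IH] al r r0 r1.
  split=> //=; rewrite /ball_mono /nsq /mono !big_ord0 sqr_ge0.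
  by rewrite addn0 expr0 mulr1.
set al' := fun i => al (lift ord0 i); set k := (\sum_i al' i)%N.
have slice s : iter_integrable (fun v => ball_mono r al (vcons s v)) /\
    cube_int (fun v => ball_mono r al (vcons s v)) =
    ball_mom al' * (if s ^+ 2 <= r ^+ 2 then bker r (al ord0) (n + k) s else 0).
  have [sr|sr] := boolP (s ^+ 2 <= r ^+ 2).
    have -> : (fun v => ball_mono r al (vcons s v)) =
        (fun v => s ^+ al ord0 * ball_mono (Num.sqrt (r ^+ 2 - s ^+ 2)) al' v).
      by apply/funext => v; rewrite ball_mono_vcons sr.
    have [||g i] := IH al' (Num.sqrt (r ^+ 2 - s ^+ 2)).
    - exact: sqrtr_ge0.
    - rewrite -[leRHS]sqrtr1 ler_sqrt//; have := sqr_ge0 s; nra.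
    have [g' ->] := cube_intZ (s ^+ al ord0) g; split=> //.
    by rewrite i /bker -/k; ring.
  have -> : (fun v => ball_mono r al (vcons s v)) = (fun _ : pt R n => 0).
    by apply/funext => v; rewrite ball_mono_vcons (negbTE sr).
  by have [? ->] := cube_int0 R n; rewrite mulr0.
have slE : (fun s => cube_int (fun v => ball_mono r al (vcons s v))) =
    (fun s => ball_mom al' * (if s ^+ 2 <= r ^+ 2 then bker r (al ord0) (n + k) s else 0)).
  by apply/funext => s; case: (slice s).
split.
  split=> [s|]; first by case: (slice s).
  rewrite slE; have := integrableZl (@measurable_I11 R) (ball_mom al') (integrable_bker r (al ord0) (n + k)).
  exact.
rewrite /= slE RintegralZl//; last exact: integrable_bker.
rewrite bker_scale// mulrCA; congr (_ * _); last by rewrite mulrC.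
by rewrite big_ord_recl -/k; congr (_ ^+ _); rewrite -/al'; lia.
Qed.

Lemma ball_mom_odd n (al : 'I_n -> nat) i : odd (al i) -> ball_mom al = 0.
Proof.
elim: n al i => [|n IH] al i; first by case: i.
case: (unliftP ord0 i) => [j ->|->] o /=; last by rewrite beta_odd// mul0r.
by rewrite (IH _ j)// mulr0.
Qed.

Lemma sum_incr2 n (al : 'I_n -> nat) i :
  (\sum_j incr2 i al j = \sum_j al j + 2)%N.
Proof.
rewrite big_split/=; congr (_ + _)%N.
by rewrite (bigD1 i)//= eqxx big1 ?addn0// => j /negbTE; rewrite eq_sym => ->.
Qed.

(** The Beta factor of coordinate [i] changes by [betaS2l], those of the coordinates sliced before
    it by [betaS2r'], and the resulting quotients telescope. The ratio of moments is thus obtained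
    without Gamma functions. *)
Lemma ball_mom_incr2 n (al : 'I_n -> nat) i :
  (\sum_j al j + n + 2)%:R * ball_mom (incr2 i al) = (al i).+1%:R * ball_mom al.
Proof.
elim: n al i => [|n IH] al i; first by case: i.
case: (unliftP ord0 i) => [j ->|->] /=.
- set al' := fun i => al (lift ord0 i).
  have e' : (fun k => incr2 (lift ord0 j) al (lift ord0 k)) = incr2 j al'.
    by apply/funext => k; rewrite /incr2 (inj_eq lift_inj).
  have e0 : incr2 (lift ord0 j) al ord0 = al ord0 by rewrite /incr2 /= addn0.
  rewrite e' e0 (eq_bigr _ (fun k _ => congr1 (fun f => f k) e')) sum_incr2.
  have := IH al' j; set k := (\sum_j al' j)%N => IHj.
  have b := betaS2r' R (al ord0) (n + k).
  rewrite big_ord_recl -/k (_ : n + (k + 2) = (n + k).+2)%N; last lia.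
  rewrite (_ : al ord0 + k + n.+1 + 2 = al ord0 + (n + k) + 3)%N; last lia.
  rewrite mulrA b; transitivity (beta R (al ord0) (n + k) * ((k + n + 2)%:R * ball_mom (incr2 j al'))).
    by rewrite mulrA; congr (_ * _); rewrite mulrC; congr (_ * _%:R); lia.
  by rewrite IHj mulrCA.
- set al' := fun i => al (lift ord0 i).
  have e' : (fun k => incr2 ord0 al (lift ord0 k)) = al'.
    by apply/funext => k; rewrite /incr2 addn0.
  rewrite e' (eq_bigr _ (fun k _ => congr1 (fun f => f k) e')).
  set k := (\sum_j al' j)%N; rewrite big_ord_recl -/k.
  rewrite (_ : incr2 ord0 al ord0 = (al ord0).+2); last by rewrite /incr2 eqxx addn2.
  rewrite mulrA.
  rewrite (_ : al ord0 + k + n.+1 + 2 = al ord0 + (n + k) + 3)%N; last lia.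
  by rewrite betaS2l mulrA.
Qed.

Lemma ball_mom0_gt0 n : 0 < ball_mom (fun _ : 'I_n => 0%N).
Proof. by elim: n => [|n IH] //=; rewrite mulr_gt0// beta0_gt0. Qed.

Lemma enormE n (x : pt R n) : enorm x ^+ 2 = nsq x.
Proof. by rewrite sqr_sqrtr// nsq_ge0. Qed.

Lemma enorm_ge0 n (x : pt R n) : 0 <= enorm x.
Proof. exact: sqrtr_ge0. Qed.

Lemma nsq_le n (x : pt R n) r : 0 <= r -> (nsq x <= r ^+ 2) = (enorm x <= r).
Proof. by move=> r0; rewrite -enormE ler_sqr// nnegrE enorm_ge0. Qed.

Definition cone n (g : pt R n -> R) (x : pt R n) : R :=
  if (0 < enorm x) && (enorm x <= 1) then g (fun i => x i / enorm x) else 0.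

Lemma mono_scale n (al : 'I_n -> nat) (x : pt R n) (r : R) :
  mono al (fun i => x i / r) = mono al x / r ^+ (\sum_i al i).
Proof.
rewrite /mono -prodrXr -prodf_div; apply: eq_bigr => i _.
by rewrite expr_div_n.
Qed.

Lemma mono_le n (al : 'I_n -> nat) (x : pt R n) :
  `|mono al x| <= enorm x ^+ (\sum_i al i).
Proof.
rewrite /mono normr_prod -prodrXr; apply: ler_prod => i _; rewrite normr_ge0/= normrX.
apply: lerXn2r; rewrite ?nnegrE ?enorm_ge0// -sqrtr_sqr ler_sqrt ?nsq_ge0//.
rewrite (bigD1 i)//= lerDl; apply: sumr_ge0 => j _; exact: sqr_ge0.
Qed.

(** On the cone, a monomial of degree [k] becomes [mono al x / |x|^k]. Cutting the ball into [m.+1]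
    shells and replacing [|x|] by the outer radius of its shell gives a combination of differences
    of [ball_mono], whose integrals are known. The outer radius also keeps the quotient at most 1 in
    absolute value, as dominated convergence requires. *)
Definition step_weight (m k : nat) (j : nat) : R := ((j.+1%:R / m.+1%:R) ^+ k)^-1.

Definition step_fun n m (al : 'I_n -> nat) (x : pt R n) : R :=
  \sum_(j < m.+1) step_weight m (\sum_i al i) j *
    (ball_mono (j.+1%:R / m.+1%:R) al x - ball_mono (j%:R / m.+1%:R) al x).

(** A Riemann-Stieltjes sum for the integral of [r^(-k) d(r^(n+k))] over [[0, 1]]. It sees the
    exponents only through their sum [k], so within one degree the sphere moments are proportional
    to the ball moments. *)
Definition cone_factor_seq n k m : R := \sum_(j < m.+1) step_weight m k j *
  ((j.+1%:R / m.+1%:R) ^+ (n + k) - (j%:R / m.+1%:R) ^+ (n + k)).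

Lemma step_moment n m (al : 'I_n -> nat) : iter_integrable (step_fun m al) /\
  cube_int (step_fun m al) = cone_factor_seq n (\sum_i al i) m * ball_mom al.
Proof.
have bmono (j : nat) : (j <= m.+1)%N -> iter_integrable (ball_mono (j%:R / m.+1%:R) al) /\
   cube_int (ball_mono (j%:R / m.+1%:R) al) =
   (j%:R / m.+1%:R) ^+ (n + \sum_i al i) * ball_mom al.
  move=> jm; apply: ball_moment; first by rewrite divr_ge0.
  by rewrite ler_pdivrMr ?mul1r ?ler_nat// ltr0n.
have db (j : 'I_m.+1) : iter_integrable (fun x => ball_mono (j.+1%:R / m.+1%:R) al x
      - ball_mono (j%:R / m.+1%:R) al x) /\
   cube_int (fun x => ball_mono (j.+1%:R / m.+1%:R) al x
      - ball_mono (j%:R / m.+1%:R) al x) =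
   ((j.+1%:R / m.+1%:R) ^+ (n + \sum_i al i) - (j%:R / m.+1%:R) ^+ (n + \sum_i al i)) * ball_mom al.
  have [g1 i1] := bmono j.+1 (ltn_ord j); have [g2 i2] := bmono j (ltnW (ltn_ord j)).
  have [g3 i3] := cube_intZ (-1) g2.
  have e : (fun x => ball_mono (j.+1%:R / m.+1%:R) al x - ball_mono (j%:R / m.+1%:R) al x)
    = (fun x => ball_mono (j.+1%:R / m.+1%:R) al x + -1 * ball_mono (j%:R / m.+1%:R) al x).
    by apply/funext => x; rewrite mulN1r.
  by rewrite e; have [? ->] := cube_intD g1 g3; rewrite i1 i3 i2 mulN1r mulrBl.
have [g i] := @cube_int_sum R n _ (index_enum 'I_m.+1)
   (fun j => step_weight m (\sum_i al i) j) _ (fun j => (db j).1).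
split=> //; rewrite /step_fun i /cone_factor_seq mulr_suml; apply: eq_bigr => j _.
by rewrite (db j).2 mulrA.
Qed.

(** A point of the punctured ball lies in exactly one shell, found as the least grid radius reaching
    [enorm x]. In all other shells, and everywhere for points outside the punctured ball, the two
    [ball_mono] terms cancel. *)
Lemma step_funE n m (al : 'I_n -> nat) (x : pt R n) :
  if (0 < enorm x) && (enorm x <= 1) then
    exists c : nat, [/\ (enorm x <= c.+1%:R / m.+1%:R), (c%:R / m.+1%:R < enorm x)
      & step_fun m al x = step_weight m (\sum_i al i) c * mono al x]
  else step_fun m al x = 0.
Proof.
have m0 : (0 : R) < m.+1%:R by rewrite ltr0n.
have bE (j : nat) : ball_mono (j%:R / m.+1%:R) al x =
    if enorm x <= j%:R / m.+1%:R then mono al x else 0.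
  by rewrite /ball_mono nsq_le// divr_ge0.
have [/andP[x0 x1]|] := boolP ((0 < enorm x) && (enorm x <= 1)); last first.
  rewrite negb_and -leNgt -ltNge => x01; apply: big1 => j _; rewrite !bE.
  have [x0|x1] := orP x01.
    by rewrite !ifT ?subrr ?mulr0// (le_trans x0)// divr_ge0.
  have h (i : nat) : (i <= m.+1)%N -> (enorm x <= i%:R / m.+1%:R) = false.
    move=> im; apply/negbTE; rewrite -ltNge; apply: le_lt_trans x1.
    by rewrite ler_pdivrMr ?mul1r ?ler_nat.
  by have jm := ltn_ord j; rewrite !h ?subrr ?mulr0//; lia.
have ex : exists c, enorm x <= c%:R / m.+1%:R.
  by exists m.+1; rewrite divff// gt_eqF.
case: (ex_minnP ex) => -[|c] hc cmin.
  by move: hc; rewrite mul0r leNgt x0.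
have cm : (c < m.+1)%N by apply: cmin; rewrite divff// gt_eqF.
have nc (j : nat) : (j <= c)%N -> (enorm x <= j%:R / m.+1%:R) = false.
  by move=> jc; apply/negbTE/negP => /cmin; lia.
exists c; split=> //.
  by rewrite ltNge nc.
rewrite /step_fun (bigD1 (Ordinal cm))//= [X in _ + X = _]big1 ?addr0 => [|j].
  by rewrite !bE hc nc//= subr0.
rewrite -val_eqE/= neq_ltn => /orP[jc|cj]; rewrite !bE.
  by rewrite !nc/= ?subrr ?mulr0// ltnW.
have h (i : nat) : (c.+1 <= i)%N -> enorm x <= i%:R / m.+1%:R.
  by move=> ci; apply: (le_trans hc); rewrite ler_pM2r ?invr_gt0// ler_nat.
by rewrite !h ?subrr ?mulr0//; lia.
Qed.

Lemma step_fun_bounded n m (al : 'I_n -> nat) (x : pt R n) : `|step_fun m al x| <= 1.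
Proof.
have := step_funE m al x; case: ifPn => [/andP[x0 x1] [c [h1 h2 ->]]|_ ->]; last first.
  by rewrite normr0.
rewrite normrM /step_weight.
have c0 : 0 < (c.+1%:R / m.+1%:R : R) by exact: lt_le_trans h1.
rewrite ger0_norm ?invr_ge0 ?exprn_ge0 ?(ltW c0)// mulrC ler_pdivrMr ?exprn_gt0// mul1r.
apply: (le_trans (mono_le al x)); rewrite lerXn2r ?nnegrE ?enorm_ge0//; exact: ltW.
Qed.

Lemma step_fun_cvg n (al : 'I_n -> nat) (x : pt R n) :
  (fun m => step_fun m al x) @ \oo --> cone (mono al) x.
Proof.
rewrite /cone; have hE := fun m => step_funE m al x.
move: hE; case: ifPn => [/andP[x0 x1] hE|_ hE]; last first.
  by rewrite (_ : (fun m => _) = (fun=> 0)); [exact: cvg_cst|apply/funext => m; exact: hE].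
rewrite mono_scale.
have /boolp.choice[c hc] := hE.
have cc : (fun m => (c m).+1%:R / m.+1%:R : R) @ \oo --> enorm x.
  apply: (@squeeze_cvgr _ _ _ _ (fun=> enorm x) (fun m => enorm x + m.+1%:R^-1)).
  - apply: nearW => m; case: (hc m) => h1 h2 _; rewrite h1/=.
    by rewrite -addn1 natrD mulrDl mul1r lerD2r ltW.
  - exact: cvg_cst.
  - rewrite -[X in _ --> X]addr0; apply: cvgD; first exact: cvg_cst.
    exact: cvg_harmonic.
rewrite (_ : (fun m => _) = (fun m =>
  mono al x * (((c m).+1%:R / m.+1%:R) ^+ (\sum_i al i))^-1)); last first.
  by apply/funext => m; case: (hc m) => _ _ ->; rewrite mulrC.
apply: cvgM; first exact: cvg_cst.
apply: cvgV; first by rewrite expf_neq0// gt_eqF.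
exact: (continuous_cvg _ (@exprn_continuous _ _ _) cc).
Qed.

Definition cone_factor n k : R := lim (cone_factor_seq n k @ \oo).

Lemma cone_moment n (al : 'I_n -> nat) : iter_integrable (cone (mono al)) /\
  cube_int (cone (mono al)) = cone_factor n (\sum_i al i) * ball_mom al.
Proof.
have [g c] := cube_int_cvg (fun m => (step_moment m al).1)
  (fun m x => step_fun_bounded m al x) (fun x => @step_fun_cvg n al x).
split=> //.
have {}c : (fun m => cone_factor_seq n (\sum_i al i) m * ball_mom al) @ \oo --> cube_int (cone (mono al)).
  rewrite (_ : (fun m => _) = (fun m => cube_int (step_fun m al)))//.
  by apply/funext => m; rewrite (step_moment m al).2.
(* Dominated convergence controls only the product of the factor with [ball_mom al]. A nonzero
   moment can be divided out, which proves that the factor converges; for a zero moment both sides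
   are 0. *)
have [m0|m0] := eqVneq (ball_mom al) 0.
  move: c; rewrite m0 mulr0 (_ : (fun m => _) = (fun=> 0)); last first.
    by apply/funext => m; rewrite mulr0.
  by move=> c; apply: (cvg_unique _ c (cvg_cst _)).
have c' : cone_factor_seq n (\sum_i al i) @ \oo --> cube_int (cone (mono al)) / ball_mom al.
  rewrite (_ : cone_factor_seq _ _ = (fun m => cone_factor_seq n (\sum_i al i) m * ball_mom al * (ball_mom al)^-1)).
    by apply: cvgM => //; exact: cvg_cst.
  by apply/funext => m; rewrite mulfK.
by rewrite /cone_factor (cvg_lim _ c')// divfK.
Qed.

Lemma cone_factor0 n : (0 < n)%N -> cone_factor n 0 = 1.
Proof.
move=> n0; rewrite /cone_factor (_ : cone_factor_seq n 0 = (fun=> 1)); first by apply/cvg_lim => //; exact: cvg_cst.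
apply/funext => m; rewrite /cone_factor_seq.
under eq_bigr do rewrite /step_weight expr0 invr1 mul1r addn0.
rewrite -(big_mkord xpredT (fun j => (j.+1%:R / m.+1%:R) ^+ n - (j%:R / m.+1%:R) ^+ n)).
rewrite telescope_sumr// divff ?pnatr_eq0// expr1n mul0r expr0n.
by rewrite (gtn_eqF n0) subr0.
Qed.

End SphereMoments.

(** * The spherical mean as a linear functional on formal polynomials *)

Section SphereFunctional.
Variables (R : realType) (d : nat).
Local Notation n := d.+1.
Local Notation mp := (mpoly n R).

Lemma sphere_intE (g : pt R n -> R) :
  sphere_int g = cube_int (cone g) / ball_mom R (fun _ : 'I_n => 0%N).
Proof.
congr (_ / _); have [_] := @ball_moment R n (fun=> 0%N) 1 ler01 (lexx _).
rewrite big1// expr1n mul1r => <-; apply: eq_cube_int => x.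
by rewrite /ball_mono nsq_le ?ler01// /mono big1// => i _; rewrite expr0.
Qed.

Lemma enorm_normalize m (x : pt R m) : 0 < enorm x -> enorm (fun i => x i / enorm x) = 1.
Proof.
move=> x0; apply/eqP; rewrite -(@eqrXn2 _ 2) ?enorm_ge0// enormE expr1n /nsq.
under eq_bigr do rewrite expr_div_n.
by rewrite -mulr_suml -/(nsq x) -enormE divff// expf_neq0// gt_eqF.
Qed.

Lemma eq_sphere_int (g h : pt R n -> R) :
  (forall x, enorm x = 1 -> g x = h x) -> sphere_int g = sphere_int h.
Proof.
move=> gh; rewrite !sphere_intE; congr (_ / _); apply: eq_cube_int => x.
by rewrite /cone; case: ifP => // /andP[x0 _]; rewrite gh// enorm_normalize.
Qed.

Lemma sphere_int_ge0 (g : pt R n -> R) :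
  (forall x, enorm x = 1 -> 0 <= g x) -> 0 <= sphere_int g.
Proof.
move=> g0; rewrite sphere_intE divr_ge0 ?(ltW (ball_mom0_gt0 _ _))//.
apply: cube_int_ge0 => x; rewrite /cone; case: ifP => // /andP[x0 _].
by rewrite g0// enorm_normalize.
Qed.

Definition smean (p : mp) : R := sphere_int (fun x : pt R n => meval x p).

Lemma cone_meval (p : mp) (x : pt R n) : cone (fun x => meval x p) x =
  \sum_(m <- msupp p) mcoeff m p * cone (mono (fun i => m i)) x.
Proof.
rewrite /cone; case: ifP => _; first by rewrite mevalE.
by rewrite big1// => m _; rewrite mulr0.
Qed.

Lemma iter_integrable_cone_meval (p : mp) : iter_integrable (cone (fun x : pt R n => meval x p)).
Proof.
rewrite (_ : cone _ = (fun x => \sum_(m <- msupp p) mcoeff m p * cone (mono (fun i => m i)) x)).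
  by apply: (cube_int_sum _ _ _).1 => m; apply: (@cone_moment R n _).1.
by apply/funext => x; exact: cone_meval.
Qed.

Lemma smean_is_linear : linear_for *%R smean.
Proof.
move=> c p q; rewrite /smean !sphere_intE.
have [gZ iZ] := cube_intZ c (iter_integrable_cone_meval p).
have [_ iD] := cube_intD gZ (iter_integrable_cone_meval q).
rewrite mulrA -mulrDl -iZ -iD; congr (_ / _); apply: eq_cube_int => x.
rewrite /cone; case: ifP => _; last by rewrite mulr0 addr0.
by rewrite mevalD mevalZ.
Qed.

HB.instance Definition _ := GRing.isLinear.Build R mp R *%R smean smean_is_linear.

Lemma eq_smean (p q : mp) : (forall x, enorm x = 1 -> meval x p = meval x q) -> smean p = smean q.
Proof. exact: eq_sphere_int. Qed.

Lemma smean_sqr_ge0 (p : mp) : 0 <= smean (p * p).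
Proof. by apply: sphere_int_ge0 => x _; rewrite mevalM -expr2 sqr_ge0. Qed.

Lemma smean_monoE m : smean (mpolyX R m) =
  cone_factor R n (mdeg m) * ball_mom R (fun i => m i) / ball_mom R (fun _ : 'I_n => 0%N).
Proof.
rewrite /smean sphere_intE; congr (_ / _); rewrite mdegE -(@cone_moment R n _).2.
by apply: eq_cube_int => x; rewrite /cone; case: ifP => // _; rewrite mevalX.
Qed.

Lemma smean1 : smean 1 = 1.
Proof.
rewrite -mpolyX0 smean_monoE mdeg0 cone_factor0// mul1r.
rewrite (_ : (fun i => _) = (fun=> 0%N)); last by apply/funext => i; rewrite mnm0E.
by rewrite divff// gt_eqF// ball_mom0_gt0.
Qed.

Lemma smean_odd (m : multinom n) i : odd (m i) -> smean (mpolyX R m) = 0.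
Proof. by move=> o; rewrite smean_monoE (@ball_mom_odd R _ _ i)// mulr0 mul0r. Qed.

Lemma sphere_sqr_sum (x : pt R n) : enorm x = 1 -> \sum_i x i ^+ 2 = 1.
Proof. by move=> x1; rewrite -[LHS]/(nsq x) -enormE x1 expr1n. Qed.

(* The normalisation constant [cone_factor] is eliminated by summing over [i]:
   the squares of the coordinates add up to [1] on the sphere. *)
Lemma smean_incr (m : multinom n) i :
  (mdeg m + n)%:R * smean (mpolyX R (mnm_add (mnm_add m (mnm1 i)) (mnm1 i))) =
  (m i).+1%:R * smean (mpolyX R m).
Proof.
pose up j := mnm_add (mnm_add m (mnm1 j)) (mnm1 j).
have upE j : (fun k => up j k) = incr2 j (fun k => m k).
  by apply/funext => k; rewrite /incr2 !mnmDE !mnm1E -addnn addnA.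
pose K := cone_factor R n (mdeg m + 2) / ball_mom R (fun _ : 'I_n => 0%N).
have IE j : (mdeg m + n + 2)%:R * smean (mpolyX R (up j)) = K * ((m j).+1%:R * ball_mom R (fun k => m k)).
  have dE : mdeg (up j) = (mdeg m + 2)%N by rewrite !mdegD !mdeg1 -addnA.
  rewrite smean_monoE dE upE /K -ball_mom_incr2 -mdegE; ring.
have sE : smean (mpolyX R m) = \sum_j smean (mpolyX R (up j)).
  rewrite -linear_sum/=; apply: eq_smean => x x1.
  rewrite raddf_sum/= -[LHS]mulr1 -(sphere_sqr_sum x1) mulr_sumr.
  by apply: eq_bigr => j _; rewrite /up !mpolyXD !mevalM !mevalXU -mulrA -expr2.
have N2 : (mdeg m + n + 2)%:R != 0 :> R by rewrite pnatr_eq0; lia.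
have tot : (mdeg m + n + 2)%:R * smean (mpolyX R m) = (mdeg m + n)%:R * (K * ball_mom R (fun k => m k)).
  rewrite sE mulr_sumr (eq_bigr _ (fun j _ => IE j)) -mulr_sumr -mulr_suml mulrCA.
  congr (_ * _).
  rewrite -natr_sum; congr _%:R; rewrite mdegE.
  by under eq_bigr do rewrite -addn1; rewrite big_split/= sum_nat_const card_ord muln1.
apply: (mulfI N2); rewrite -/(up i) mulrCA IE [RHS]mulrCA tot; ring.
Qed.

End SphereFunctional.

(** * Polynomials on the sphere and orthogonal invariance *)

Section SphereAlgebra.
Variables (R : realType) (d : nat).
Local Notation n := d.+1.
Local Notation mp := (mpoly n R).
Local Notation smean := (@smean R d).
Local Notation X m := (mpolyX R m).
Local Notation XU i := (mpolyX R (mnm1 i)).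
Local Notation "m +U i" := (mnm_add m (mnm1 i)) (at level 50, left associativity).

Implicit Types (p q : mp) (m : multinom n).

Lemma smeanZ c p : smean (c *: p) = c * smean p.
Proof. exact: linearZ. Qed.

Lemma mnm_ind (P : multinom n -> Prop) :
  P mnm0 -> (forall m i, P m -> P (m +U i)) -> forall m, P m.
Proof.
move=> P0 PS m; have [k] := ubnP (mdeg m); elim: k m => // k IH m mk.
have [->//|m0] := eqVneq m mnm0.
have /existsP[i mi] : [exists i, (0 < m i)%N].
  apply: contraNT m0; rewrite negb_exists => /forallP m0; apply/eqP/mnmP => i.
  by rewrite mnm0E; have := m0 i; rewrite -leqNgt leqn0 => /eqP.
have mE : m = mnm_sub m (mnm1 i) +U i.
  by apply/mnmP => j; rewrite mnmDE mnmBE mnm1E; case: eqP => [<-|_] /=; lia.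
rewrite mE; apply/PS/IH; move: mk; rewrite {1}mE mdegD mdeg1; lia.
Qed.

Lemma mderivXU (i j : 'I_n) : mderiv j (XU i) = (i == j)%:R.
Proof.
rewrite mderivX mnm1E; case: eqP => [->|_]; last by rewrite scale0r.
rewrite scale1r (_ : mnm_sub _ _ = mnm0) ?mpolyX0//.
by apply/mnmP => k; rewrite mnmBE mnm0E subnn.
Qed.

Lemma mpoly_ring_ind (P : mp -> Prop) :
  (forall c, P (mpolyC n c)) -> (forall i, P (XU i)) ->
  (forall p q, P p -> P q -> P (p + q)) -> (forall p q, P p -> P q -> P (p * q)) ->
  forall p, P p.
Proof.
move=> PC PX PD PM; elim/mpolyind => [|c m p _ _ Pp]; first by rewrite -mpolyC0; exact: PC.
apply: PD => //; rewrite -mul_mpolyC; apply: (PM) (PC c) _.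
elim/mnm_ind: m => [|m i Pm]; first by rewrite mpolyX0 -mpolyC1; exact: PC.
by rewrite mpolyXD; exact: PM.
Qed.

(** The lower bound makes homogeneity ([degin k k]) and the two-degree space [degin t.-1 t]
    expressible. As a condition on the support it admits 0 in every range. *)
Definition degin lo hi (p : mp) := forall m, m \in msupp p -> (lo <= mdeg m <= hi)%N.

Lemma degin0 lo hi : degin lo hi 0.
Proof. by move=> m; rewrite msupp0. Qed.

Lemma deginX m : degin (mdeg m) (mdeg m) (X m).
Proof. by move=> m'; rewrite msuppX inE => /eqP ->; rewrite leqnn. Qed.

Lemma deginW lo hi lo' hi' p : (lo' <= lo)%N -> (hi <= hi')%N ->
  degin lo hi p -> degin lo' hi' p.
Proof. by move=> h1 h2 dp m /dp/andP[m1 m2]; apply/andP; lia. Qed.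

Lemma deginD lo hi p q : degin lo hi p -> degin lo hi q -> degin lo hi (p + q).
Proof. by move=> dp dq m /msuppD_le; rewrite mem_cat => /orP[/dp|/dq]. Qed.

Lemma deginZ lo hi c p : degin lo hi p -> degin lo hi (c *: p).
Proof. by move=> dp m /msuppZ_le/dp. Qed.

Lemma deginB lo hi p q : degin lo hi p -> degin lo hi q -> degin lo hi (p - q).
Proof. by move=> dp dq; rewrite -scaleN1r; apply/deginD => //; exact: deginZ. Qed.

Lemma degin_sum lo hi (J : Type) (r : seq J) (P : pred J) (F : J -> mp) :
  (forall j, P j -> degin lo hi (F j)) -> degin lo hi (\sum_(j <- r | P j) F j).
Proof. by move=> dF; apply: big_ind => // [|p q]; [exact: degin0|exact: deginD]. Qed.

Lemma deginM lo hi lo' hi' p q : degin lo hi p -> degin lo' hi' q ->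
  degin (lo + lo') (hi + hi') (p * q).
Proof.
move=> dp dq m /msuppM_le/allpairsP[[m1 m2] /= [/dp h1 /dq h2 ->]].
by rewrite mdegD; lia.
Qed.

Lemma degin1 : degin 0 0 (1 : mp).
Proof. by rewrite -mpolyX0; have := @deginX mnm0; rewrite mdeg0. Qed.

Lemma degin_exp p k : degin 1 1 p -> degin k k (p ^+ k).
Proof.
move=> dp; elim: k => [|k IH]; first exact: degin1.
by rewrite exprS -add1n; exact: deginM.
Qed.

Lemma degin_prod_exp (F : 'I_n -> mp) (m : multinom n) :
  (forall i, degin 1 1 (F i)) -> degin (mdeg m) (mdeg m) (\prod_i F i ^+ m i).
Proof.
move=> dF; rewrite mdegE.
apply: (big_ind2 (fun p k => degin k k p)); [exact: degin1|by move=> *; exact: deginM|].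
by move=> i _; apply: degin_exp.
Qed.

Lemma degin_deriv lo hi i p : degin lo hi p -> degin lo.-1 hi.-1 (mderiv i p).
Proof.
move=> dp m; rewrite mcoeff_msupp mcoeff_mderiv => c0.
have : m +U i \in msupp p.
  by rewrite mcoeff_msupp; apply: contraNN c0 => /eqP ->; rewrite mul0rn.
by move/dp; rewrite mdegD mdeg1; lia.
Qed.

Lemma smean_odd_deg (m : multinom n) : odd (mdeg m) -> smean (X m) = 0.
Proof.
move=> o; have /existsP[i mi] : [exists i, odd (m i)]; last exact: smean_odd mi.
apply: contraTT o; rewrite negb_exists => /forallP h; rewrite mdegE.
by apply: (big_ind (fun k => ~~ odd k)) => // a b ea eb; rewrite oddD (negbTE ea).
Qed.

(** The recursion [smean_incr] after stripping one factor [x_i] from the monomial. If [x_i] does not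
    divide it, the right side is 0 and the left side vanishes by parity. *)
Lemma smean_stein_mono (m : multinom n) i :
  (d + mdeg m)%:R * smean (XU i * X m) = smean (mderiv i (X m)).
Proof.
rewrite mderivX linearZ/=; case mi: (m i) => [|k].
  rewrite mul0r (_ : XU i * X m = X (m +U i)); last by rewrite mpolyXD mulrC.
  by rewrite (@smean_odd _ _ _ i) ?mulr0// mnmDE mi mnm1E eqxx.
set m' := mnm_sub m (mnm1 i).
have mE : m = m' +U i.
  by apply/mnmP => j; rewrite mnmDE mnmBE mnm1E; case: eqP => [<-|_] /=; lia.
have m'i : m' i = k by rewrite mnmBE mnm1E eqxx mi subn1.
rewrite (_ : XU i * X m = X (m' +U i +U i)); last by rewrite {1}mE !mpolyXD; ring.
by rewrite -m'i -smean_incr mE mdegD mdeg1; congr (_%:R * _); lia.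
Qed.

Lemma degin_ind lo hi (P : mp -> Prop) :
  P 0 -> (forall p q, P p -> P q -> P (p + q)) ->
  (forall c m, (lo <= mdeg m <= hi)%N -> P (c *: X m)) ->
  forall p, degin lo hi p -> P p.
Proof.
move=> P0 PD PX p dp; rewrite [p]mpolyE big_seq; apply: big_ind => // m /dp.
exact: PX.
Qed.

Lemma smean_stein k p i : degin k k p ->
  (d + k)%:R * smean (XU i * p) = smean (mderiv i p).
Proof.
apply: (@degin_ind k k (fun p => _ * smean (XU i * p) = smean (mderiv i p))) => [|{}p q IHp IHq|c m mk].
- by rewrite mulr0 mderiv0 !linear0 mulr0.
- by rewrite mulrDr mderivD !linearD/= mulrDr IHp IHq.
- have {}mk : mdeg m = k by lia.
  by rewrite -[XU i * _]scalerAr mderivZ !smeanZ mulrCA -smean_stein_mono mk.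
Qed.

(* Only one of two consecutive degrees is odd, and even degrees of [p] contribute
   nothing to either side, so one constant serves both degrees. *)
Lemma smean_stein2 k p i : degin k k.+1 p ->
  (d + (k + ~~ odd k))%:R * smean (XU i * p) = smean (mderiv i p).
Proof.
apply: (@degin_ind k k.+1 (fun p => _ * smean (XU i * p) = smean (mderiv i p))) => [|{}p q IHp IHq|c m mk].
- by rewrite mulr0 mderiv0 !linear0 mulr0.
- by rewrite mulrDr mderivD !linearD/= mulrDr IHp IHq.
rewrite -[XU i * _]scalerAr mderivZ !smeanZ mulrCA; congr (_ * _); rewrite -smean_stein_mono.
have [om|em] := boolP (odd (mdeg m)).
  congr (_%:R * _); congr (_ + _)%N.
  have [h|h] : mdeg m = k \/ mdeg m = k.+1 by lia.
    by rewrite -h om addn0.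
  by move: om; rewrite h /= => ->; rewrite addn1.
rewrite (_ : XU i * X m = X (m +U i)); last by rewrite mpolyXD mulrC.
by rewrite smean_odd_deg ?mulr0// mdegD mdeg1 addn1.
Qed.

Lemma smean_null_mul (p q : mp) : smean (p * p) = 0 -> smean (p * q) = 0.
Proof.
move=> p0; apply/eqP; apply: contraT => pq.
(* Were [b] nonzero, this [s] would give the square of [q + s p] the mean
   [smean (q * q) + 2 s b = -1]. *)
set b := smean (p * q) in pq *; set s := - (smean (q * q) + 1) / (2 * b).
have := smean_sqr_ge0 (q + s *: p).
rewrite mulrDl !mulrDr -!scalerAl -!scalerAr !linearD !linearZ/= p0 (mulrC q p) -/b.
have -> : smean (q * q) + s * b + (s * b + s * (s * 0)) = - 1.
  by rewrite /s; field.
lra.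
Qed.

(** By [smean_stein2] the mean of [d_i (p x^m)] is a multiple of the mean of [p (x_i x^m)], which is
    0. The product rule leaves [(d_i p) x^m], since [p] is also null against [d_i x^m]. *)
Lemma null_deriv k p i : degin k k.+1 p -> (forall q, smean (p * q) = 0) ->
  forall q, smean (mderiv i p * q) = 0.
Proof.
move=> dp np q; rewrite [q]mpolyE mulr_sumr linear_sum/=; apply: big1_seq => m _.
rewrite -scalerAr linearZ/=; apply/eqP; rewrite mulf_eq0; apply/orP; right; apply/eqP.
have := smean_stein2 i (deginM dp (@deginX m)).
have -> : XU i * (p * X m) = p * (XU i * X m) by ring.
by rewrite np mulr0 mderivM linearD/= (np (mderiv i (X m))) addr0 => <-.
Qed.

Lemma mderiv_eq0 p : (forall i, mderiv i p = 0) -> p = mpolyC n (mcoeff mnm0 p).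
Proof.
move=> dp; apply/mpolyP; elim/mnm_ind => [|m i _]; first by rewrite mcoeffC eqxx mulr1.
have : mcoeff m (mderiv i p) = 0 by rewrite dp mcoeff0.
rewrite mcoeff_mderiv => /eqP; rewrite mulrn_eq0/= => /eqP ->.
by rewrite mcoeffC mnmD_eq0 mnm1_eq0 andbF mulr0.
Qed.

(** Derivatives are null of lower degree, hence 0 by induction, so [p] is constant, and pairing with
    1 makes the constant 0. Consecutive degrees matter: with a gap of two, [1 - |x|^2] would be a
    counterexample. *)
Lemma null_eq0 k p : degin k.-1 k p -> (forall q, smean (p * q) = 0) -> p = 0.
Proof.
have cst0 c : (forall q, smean (mpolyC n c * q) = 0) -> mpolyC n c = 0.
  by move/(_ 1); rewrite mulr1 -[mpolyC n c]mulr1 mul_mpolyC linearZ/= smean1 mulr1 => ->;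
    rewrite scale0r.
elim: k p => [|k IH] p dp np.
  have pE : p = mpolyC n (mcoeff mnm0 p).
    apply/mpolyP => m; rewrite mcoeffC; have [->|m0] := eqVneq m mnm0; first by rewrite mulr1.
    rewrite mulr0; apply/eqP; rewrite mcoeff_eq0; apply/negP => /dp.
    by rewrite leqn0 mdeg_eq0 (negbTE m0).
  by rewrite pE; apply: cst0; rewrite -pE.
have pE : p = mpolyC n (mcoeff mnm0 p).
  apply: mderiv_eq0 => i; apply: IH; first exact: (degin_deriv dp).
  exact: (null_deriv i dp np).
by rewrite pE; apply: cst0; rewrite -pE.
Qed.

Lemma smean_definite k p : degin k.-1 k p -> smean (p * p) = 0 -> p = 0.
Proof. by move=> dp p0; apply: (null_eq0 dp) => q; exact: smean_null_mul. Qed.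

(** * Invariance of the mean under orthogonal substitutions *)

Definition act (Q : 'I_n -> 'I_n -> R) (x : pt R n) : pt R n := fun i => \sum_j Q i j * x j.

Definition linform (Q : 'I_n -> 'I_n -> R) i : mp := \sum_j Q i j *: XU j.

Definition pull (Q : 'I_n -> 'I_n -> R) (p : mp) : mp :=
  comp_mpoly [tuple linform Q i | i < n] p.

Definition orthogonal (Q : 'I_n -> 'I_n -> R) :=
  forall i l, \sum_j Q i j * Q l j = (i == l)%:R.

Lemma meval_pull Q p x : meval x (pull Q p) = meval (act Q x) p.
Proof.
rewrite comp_mpoly_meval; apply: meval_eq => i; rewrite tnth_mktuple raddf_sum/=.
by apply: eq_bigr => j _; rewrite mevalZ mevalXU.
Qed.

Lemma pullM Q p q : pull Q (p * q) = pull Q p * pull Q q.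
Proof. exact: rmorphM. Qed.

Lemma pullD Q p q : pull Q (p + q) = pull Q p + pull Q q.
Proof. exact: comp_mpolyD. Qed.

Lemma pullXU Q i : pull Q (XU i) = linform Q i.
Proof. by rewrite /pull comp_mpolyXU -tnth_nth tnth_mktuple. Qed.

Lemma degin_linform Q i : degin 1 1 (linform Q i).
Proof.
apply: degin_sum => j _; apply: deginZ; have := @deginX (mnm1 j); by rewrite mdeg1.
Qed.

Lemma degin_pull lo hi Q p : degin lo hi p -> degin lo hi (pull Q p).
Proof.
move=> dp; rewrite /pull comp_mpolyE big_seq; apply: degin_sum => m /dp/andP[m1 m2].
apply/deginZ/(deginW m1 m2)/degin_prod_exp => i; rewrite tnth_mktuple; exact: degin_linform.
Qed.

Lemma mderiv_pull Q p j :
  mderiv j (pull Q p) = \sum_l Q l j *: pull Q (mderiv l p).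
Proof.
elim/mpoly_ring_ind: p => [c|i|p q IHp IHq|p q IHp IHq].
- rewrite /pull comp_mpolyC mderivC big1// => l _.
  by rewrite mderivC comp_mpoly0 scaler0.
- rewrite pullXU /linform raddf_sum/= (bigD1 j)//= big1 ?addr0 => [|k /negbTE kj].
    rewrite (bigD1 i)//= big1 ?addr0 => [|l /negbTE li].
      by rewrite mderivZ !mderivXU !eqxx /pull comp_mpoly1.
    by rewrite mderivXU eq_sym li /pull comp_mpoly0 scaler0.
  by rewrite mderivZ mderivXU kj scaler0.
- rewrite pullD mderivD IHp IHq -big_split/=; apply: eq_bigr => l _.
  by rewrite mderivD pullD scalerDr.
- rewrite pullM mderivM IHp IHq mulr_suml mulr_sumr -big_split/=; apply: eq_bigr => l _.
  by rewrite mderivM pullD !pullM scalerDr -scalerAl -scalerAr.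
Qed.

(** Apply the recursion to each coordinate of row [i] of [Q] and then the chain rule; orthonormality
    of the rows collapses the double sum to the term [l = i]. *)
Lemma smean_pull_step Q m i : orthogonal Q ->
  (d + mdeg m)%:R * smean (pull Q (XU i * X m)) = smean (pull Q (mderiv i (X m))).
Proof.
move=> oQ; have dpull := @degin_pull _ _ Q _ (@deginX m).
have step j : (d + mdeg m)%:R * smean (Q i j *: XU j * pull Q (X m)) =
    \sum_l Q i j * Q l j * smean (pull Q (mderiv l (X m))).
  rewrite -scalerAl linearZ/= mulrCA (smean_stein j dpull) mderiv_pull linear_sum/= mulr_sumr.
  by apply: eq_bigr => l _; rewrite linearZ/= mulrA.
rewrite pullM pullXU /linform mulr_suml linear_sum/= mulr_sumr.
rewrite (eq_bigr _ (fun j _ => step j)) exchange_big/=.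
under eq_bigr do rewrite -mulr_suml oQ.
rewrite (bigD1 i)//= big1 ?addr0 => [|l /negbTE li]; first by rewrite eqxx mul1r.
by rewrite eq_sym li mul0r.
Qed.

(** The mean and the rotated mean satisfy the same recursion, which lowers the degree by two, and
    they agree on 1. Here [0 < d] keeps the factor [d + mdeg m] nonzero even for [m = 0]. *)
Lemma smean_pull_mono Q m : (0 < d)%N -> orthogonal Q ->
  smean (pull Q (X m)) = smean (X m).
Proof.
move=> d0 oQ; have [k] := ubnP (mdeg m); elim: k m => // k IH m.
elim/mnm_ind: m => [_|m i _ mk]; first by rewrite mpolyX0 /pull comp_mpoly1.
have dk : (d + mdeg m)%:R != 0 :> R by rewrite pnatr_eq0; lia.
have -> : X (m +U i) = XU i * X m by rewrite mpolyXD mulrC.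
apply: (mulfI dk); rewrite smean_stein_mono smean_pull_step// mderivX.
rewrite /pull comp_mpolyZ !linearZ/= -/(pull _ _).
case mi: (m i) => [|c]; first by rewrite !mul0r.
rewrite IH//; move: mk; rewrite mdegD mdeg1 => mk.
by apply: leq_ltn_trans (mdegB _ _) _; lia.
Qed.

Lemma smean_pull Q p : (0 < d)%N -> orthogonal Q -> smean (pull Q p) = smean p.
Proof.
move=> d0 oQ; elim/mpolyind: p => [|c m p _ _ IH]; first by rewrite /pull comp_mpoly0.
by rewrite /pull comp_mpolyD comp_mpolyZ !linearD !linearZ/= -!/(pull _ _) IH smean_pull_mono.
Qed.

End SphereAlgebra.

(** * The reproducing kernel *)

Section Kernel.
Variables (R : realType) (d t : nat).
Hypothesis t0 : (0 < t)%N.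
Local Notation n := d.+1.
Local Notation mp := (mpoly n R).
Local Notation smean := (@smean R d).
Local Notation X m := (mpolyX R m).
Local Notation XU i := (mpolyX R (mnm1 i)).
Implicit Types (p q : mp) (m : multinom n) (x y : pt R n).

Definition monos_deg k : seq (multinom n) := [seq s2m u | u : k.-tuple 'I_n <- enum (basis n k)].

(* Degrees [t] and [t - 1] suffice on the sphere, where monomials may be multiplied by
   powers of the squared norm; this is where the two binomials of [dimPi] come from. *)
Definition monos : seq (multinom n) := monos_deg t ++ monos_deg t.-1.

Lemma mem_monos m : (m \in monos) = (t.-1 <= mdeg m <= t)%N.
Proof. by rewrite mem_cat -!basis_cover; lia. Qed.

Lemma uniq_monos : uniq monos.
Proof.
rewrite cat_uniq !uniq_basis/= andbT; apply/hasPn => m.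
rewrite /monos_deg -basis_cover => /eqP mt; apply/negP => /=.
by rewrite -basis_cover => /eqP; lia.
Qed.

Lemma size_monos : size monos = dimPi d t.
Proof. by rewrite size_cat !size_basis /dimPi; congr ('C(_, _) + 'C(_, _))%N; lia. Qed.

Local Notation N := (dimPi d t).

Definition bmono (a : 'I_N) : multinom n := nth mnm0 monos a.

Lemma bmono_inj : injective bmono.
Proof.
move=> a b /eqP; rewrite nth_uniq ?size_monos ?ltn_ord ?uniq_monos//.
by move=> /eqP; exact: val_inj.
Qed.

Lemma mdeg_bmono a : (t.-1 <= mdeg (bmono a) <= t)%N.
Proof. by rewrite -mem_monos mem_nth// size_monos. Qed.

Definition inV p := degin t.-1 t p.

Lemma inV_bmono a : inV (X (bmono a)).
Proof. by move=> m; rewrite msuppX inE => /eqP ->; exact: mdeg_bmono. Qed.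

Lemma bmono_surj m : (t.-1 <= mdeg m <= t)%N -> exists a, bmono a = m.
Proof.
rewrite -mem_monos => mm; have im : (index m monos < N)%N by rewrite -size_monos index_mem.
by exists (Ordinal im); rewrite /bmono nth_index.
Qed.

Lemma inVE p : inV p -> p = \sum_a mcoeff (bmono a) p *: X (bmono a).
Proof.
move=> Vp; apply/mpolyP => k; rewrite raddf_sum/=.
have [/bmono_surj[a <-]|kt] := boolP (t.-1 <= mdeg k <= t)%N.
  rewrite (bigD1 a)//= [Y in _ + Y]big1 ?addr0 => [|b ba].
    by rewrite mcoeffZ mcoeffX eqxx mulr1.
  by rewrite mcoeffZ mcoeffX (inj_eq bmono_inj) (negbTE ba) mulr0.
rewrite big1 => [|a _].
  by apply/eqP; rewrite mcoeff_eq0; apply: contra kt => /Vp.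
rewrite mcoeffZ mcoeffX; case: eqP => [ak|_]; last by rewrite mulr0.
by move: kt; rewrite -ak mdeg_bmono.
Qed.

Definition gram : 'M[R]_N := \matrix_(a, b) smean (X (bmono a) * X (bmono b)).

(** A vector killed by the Gram matrix gives a [p] in the span orthogonal to the whole basis, hence
    to itself, and [smean_definite] makes it 0. *)
Lemma gram_unit : gram \in unitmx.
Proof.
rewrite -row_free_unit -kermx_eq0; apply: contraT => /rowV0Pn[v /sub_kermxP vG v0].
pose p := \sum_a v 0 a *: X (bmono a).
have Vp : inV p by apply: degin_sum => a _; apply/deginZ/inV_bmono.
have pe b : smean (p * X (bmono b)) = 0.
  have := congr1 (fun M : 'rV_N => M 0 b) vG; rewrite !mxE => <-.
  rewrite mulr_suml linear_sum/=; apply: eq_bigr => a _.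
  by rewrite mxE -scalerAl smeanZ.
have pp : smean (p * p) = 0.
  rewrite {2}/p mulr_sumr linear_sum/= big1// => b _.
  by rewrite -[p * _]scalerAr smeanZ pe mulr0.
have p0 : p = 0 by exact: smean_definite Vp pp.
case/eqP: v0; apply/rowP => a; rewrite mxE.
have := congr1 (mcoeff (bmono a)) p0; rewrite mcoeff0 raddf_sum/= (bigD1 a)//= big1.
  by rewrite mcoeffZ mcoeffX eqxx mulr1 addr0.
by move=> b ba; rewrite mcoeffZ mcoeffX (inj_eq bmono_inj) (negbTE ba) mulr0.
Qed.

Definition igram := invmx gram.

Lemma gram_igram a b : \sum_c gram a c * igram c b = (a == b)%:R.
Proof.
have := congr1 (fun M : 'M[R]_N => M a b) (mulmxV gram_unit).
by rewrite !mxE => <-.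
Qed.

Lemma igram_gram a b : \sum_c igram a c * gram c b = (a == b)%:R.
Proof.
have := congr1 (fun M : 'M[R]_N => M a b) (mulVmx gram_unit).
by rewrite !mxE => <-.
Qed.

(** The representer of evaluation at [x]: its coordinates are the inverse Gram matrix applied to the
    values of the basis at [x]. *)
Definition kpoly x : mp := \sum_a (\sum_b igram a b * meval x (X (bmono b))) *: X (bmono a).

Definition ker x y : R := meval y (kpoly x).

Lemma inV_kpoly x : inV (kpoly x).
Proof. by apply: degin_sum => a _; apply/deginZ/inV_bmono. Qed.

Lemma smean_kpoly p x : inV p -> smean (p * kpoly x) = meval x p.
Proof.
move=> Vp; rewrite {1}(inVE Vp) mulr_suml linear_sum/=.
rewrite [in RHS](inVE Vp) raddf_sum/=; apply: eq_bigr => c _.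
rewrite -[_ *: _ * _]scalerAl smeanZ mevalZ; congr (_ * _).
rewrite /kpoly mulr_sumr linear_sum/=.
transitivity (\sum_b (\sum_a gram c a * igram a b) * meval x (X (bmono b))).
  under [RHS]eq_bigr do rewrite mulr_suml.
  rewrite exchange_big/=; apply: eq_bigr => a _.
  rewrite -[X _ * _]scalerAr smeanZ mulrC mulr_sumr; apply: eq_bigr => b _.
  by rewrite mxE mulrA.
rewrite (bigD1 c)//= [Y in _ + Y]big1 ?addr0 => [|b /negbTE bc]; first by rewrite gram_igram eqxx mul1r.
by rewrite gram_igram eq_sym bc mul0r.
Qed.

Lemma kerE x y : ker x y = smean (kpoly x * kpoly y).
Proof. by rewrite smean_kpoly//; exact: inV_kpoly. Qed.

Lemma ker_sym x y : ker x y = ker y x.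
Proof. by rewrite !kerE mulrC. Qed.

(** The two representers differ by some [r] of the space; invariance of the mean and the reproducing
    property evaluate both halves of [smean (r * r)] to [meval x r], so definiteness gives [r = 0].
    The involution hypothesis supplies the inverse of [Q]. *)
Lemma ker_act Q x y : (0 < d)%N -> orthogonal Q -> (forall z, act Q (act Q z) = z) ->
  ker (act Q x) (act Q y) = ker x y.
Proof.
move=> d0 oQ iQ; rewrite /ker -meval_pull.
suff -> : pull Q (kpoly (act Q x)) = kpoly x by [].
apply/eqP; rewrite -subr_eq0; apply/eqP; set r := _ - _.
have Vr : inV r by apply: deginB; [apply: degin_pull|]; exact: inV_kpoly.
apply: (smean_definite Vr); rewrite {2}/r mulrBr linearB/= smean_kpoly//.
suff -> : smean (r * pull Q (kpoly (act Q x))) = meval x r by rewrite subrr.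
transitivity (smean (pull Q (pull Q r * kpoly (act Q x)))).
  by apply: eq_smean => z _; rewrite pullM !mevalM !meval_pull iQ.
by rewrite smean_pull// smean_kpoly ?meval_pull ?iQ//; exact: degin_pull.
Qed.

Definition dot x y : R := \sum_i x i * y i.

Lemma dotC x y : dot x y = dot y x.
Proof. by apply: eq_bigr => i _; rewrite mulrC. Qed.

Lemma dotxx x : dot x x = enorm x ^+ 2.
Proof. by rewrite enormE; apply: eq_bigr => i _; rewrite -expr2. Qed.

Lemma dotxx_eq0 x : dot x x = 0 -> forall i, x i = 0.
Proof.
move=> /eqP; rewrite psumr_eq0 => [/allP h i|i _]; last by rewrite -expr2 sqr_ge0.
by have := h i (mem_index_enum _); rewrite -expr2 sqrf_eq0 => /eqP.
Qed.

Lemma dotBZl x y z c : dot (fun i => x i - c * y i) z = dot x z - c * dot y z.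
Proof.
by rewrite /dot mulr_sumr -sumrB; apply: eq_bigr => i _; rewrite mulrBl mulrA.
Qed.

Lemma dotBZr x y z c : dot z (fun i => x i - c * y i) = dot z x - c * dot z y.
Proof. by rewrite dotC dotBZl !(dotC z). Qed.

Definition householder (u : pt R n) : 'I_n -> 'I_n -> R :=
  fun i j => (i == j)%:R - 2 / dot u u * (u i * u j).

Lemma act_householder u x : act (householder u) x = fun i => x i - 2 * dot u x / dot u u * u i.
Proof.
apply/funext => i; rewrite /act /householder; under eq_bigr do rewrite mulrBl.
rewrite sumrB (bigD1 i)//= eqxx mul1r [Y in _ + Y - _]big1 ?addr0 => [|j /negbTE].
  congr (_ - _); rewrite [dot u x]/dot [in RHS]mulr_sumr !mulr_suml.
  by apply: eq_bigr => j _; ring.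
by rewrite eq_sym => ->; rewrite mul0r.
Qed.

Lemma householder_orthogonal u : dot u u != 0 -> orthogonal (householder u).
Proof.
move=> u0 i l; have h : dot u u != 0 by [].
have := act_householder u (householder u l) => /(congr1 (fun f => f i)).
rewrite /act => ->.
have -> : dot u (householder u l) = - u l.
  rewrite (_ : householder u l = (fun j => (l == j)%:R - 2 / dot u u * u l * u j)); last first.
    by apply/funext => j; rewrite /householder mulrA.
  rewrite dotC dotBZl (_ : dot _ u = u l); first by field.
  rewrite /dot (bigD1 l)//= eqxx mul1r big1 ?addr0// => j /negbTE.
  by rewrite eq_sym => ->; rewrite mul0r.
by rewrite /householder eq_sym; field.
Qed.

Lemma householder_invol u x : dot u u != 0 -> act (householder u) (act (householder u) x) = x.
Proof.
move=> u0; rewrite !act_householder; apply/funext => i.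
by rewrite dotBZr; field.
Qed.

Lemma dot_householder u x y : dot u u != 0 -> dot (act (householder u) x) (act (householder u) y) = dot x y.
Proof.
move=> u0; rewrite !act_householder dotBZl !dotBZr (dotC x u); field.
exact: u0.
Qed.

Lemma householder_swap x y : dot x x = dot y y -> dot (fun i => x i - y i) (fun i => x i - y i) != 0 ->
  act (householder (fun i => x i - y i)) x = y.
Proof.
move=> xy u0; rewrite act_householder; apply/funext => i.
have uE : (fun i => x i - y i) = (fun i => x i - 1 * y i).
  by apply/funext => j; rewrite mul1r.
have -> : 2 * dot (fun i => x i - y i) x / dot (fun i => x i - y i) (fun i => x i - y i) = 1.
  apply/eqP; rewrite -(inj_eq (mulIf u0)) divfK// mul1r; apply/eqP.
  rewrite {2}uE dotBZl ![dot _ (fun i => x i - y i)]dotC uE !dotBZl -xy (dotC y x); ring.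
by rewrite mul1r subKr.
Qed.

(* Two Householder reflections carry one pair of unit vectors to any other pair
   with the same inner product. *)
Lemma ker_dot x y x' y' : (0 < d)%N -> enorm x = 1 -> enorm y = 1 -> enorm x' = 1 ->
  enorm y' = 1 -> dot x y = dot x' y' -> ker x y = ker x' y'.
Proof.
move=> d0 x1 y1 x1' y1' xy.
have en z : enorm z = 1 <-> dot z z = 1.
  rewrite dotxx; split=> [->|z1]; first by rewrite expr1n.
  by apply/eqP; rewrite -(@eqrXn2 _ 2) ?enorm_ge0// z1 expr1n.
move/en in x1; move/en in y1; move/en in x1'; move/en in y1'.
have eqf u v : dot (fun i => u i - v i) (fun i => u i - v i) = 0 -> u = v.
  move=> /dotxx_eq0 h; apply/funext => i; apply/eqP; rewrite -subr_eq0; apply/eqP.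
  exact: (h i).
have [z [z1 xz ->]] : exists z, [/\ dot z z = 1, dot x' z = dot x' y' & ker x y = ker x' z].
  have [/eqf e|u0] := eqVneq (dot (fun i => x i - x' i) (fun i => x i - x' i)) 0.
    by exists y; move: xy; rewrite -e.
  exists (act (householder (fun i => x i - x' i)) y).
  rewrite dot_householder//; split=> //.
    by rewrite -xy -(dot_householder x y u0) (householder_swap _ u0) ?x1.
  by rewrite -(ker_act x y d0 (householder_orthogonal u0) (fun w => householder_invol w u0)) householder_swap ?x1.
have [/eqf ->//|u0] := eqVneq (dot (fun i => z i - y' i) (fun i => z i - y' i)) 0.
(* [x'] has equal inner products with [z] and [y'], so it lies in the mirror of the reflection
   exchanging them. *)
have fx : act (householder (fun i => z i - y' i)) x' = x'.
  rewrite act_householder; apply/funext => i.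
  have -> : dot (fun i => z i - y' i) x' = 0.
    have -> : (fun i => z i - y' i) = (fun i => z i - 1 * y' i).
      by apply/funext => j; rewrite mul1r.
    by rewrite dotBZl mul1r dotC xz dotC subrr.
  by rewrite mulr0 mul0r mul0r subr0.
by rewrite -(ker_act x' z d0 (householder_orthogonal u0) (fun w => householder_invol w u0)) fx householder_swap ?z1.
Qed.

Definition kdiag : mp := \sum_a (\sum_b igram a b *: X (bmono b)) * X (bmono a).

Lemma smean_kdiag : smean kdiag = N%:R.
Proof.
rewrite /kdiag linear_sum/=.
rewrite (eq_bigr (fun=> 1)) ?sumr_const ?card_ord// => a _.
rewrite mulr_suml linear_sum/=.
transitivity (\sum_c igram a c * gram c a); last by rewrite igram_gram eqxx.
apply: eq_bigr => b _.
by rewrite -scalerAl smeanZ mxE.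
Qed.

Lemma meval_kdiag x : meval x kdiag = ker x x.
Proof.
rewrite /ker /kpoly /kdiag !raddf_sum/=; apply: eq_bigr => a _.
rewrite mevalM mevalZ raddf_sum/=; congr (_ * _).
by apply: eq_bigr => b _; rewrite mevalZ.
Qed.

(** By [ker_dot] the diagonal is constant on the sphere, hence equal to its mean, and this mean is
    the trace of [igram] times [gram]. *)
Lemma ker_diag x : (0 < d)%N -> enorm x = 1 -> ker x x = N%:R.
Proof.
move=> d0 x1; rewrite -smean_kdiag.
transitivity (smean (mpolyC n (ker x x))).
  by rewrite -[mpolyC _ _]mulr1 mul_mpolyC smeanZ smean1 mulr1.
apply: eq_smean => z z1; rewrite mevalC meval_kdiag; apply: ker_dot => //.
by rewrite !dotxx x1 z1.
Qed.

End Kernel.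

(** * The kernel as a zonal polynomial *)

Section Zonal.
Variables (R : realType) (d t : nat).
Hypotheses (t0 : (0 < t)%N) (d0 : (0 < d)%N).
Local Notation n := d.+1.
Local Notation mp := (mpoly n R).
Local Notation smean := (@smean R d).
Local Notation X m := (mpolyX R m).
Local Notation XU i := (mpolyX R (mnm1 i)).
Local Notation "m +U i" := (mnm_add m (mnm1 i)) (at level 50, left associativity).
Local Notation N := (dimPi d t).
Local Notation ker := (@ker R d t).
Local Notation kpoly := (@kpoly R d t).
Local Notation bmono := (@bmono d t).
Local Notation igram := (@igram R d t).
Implicit Types (p q : mp) (m : multinom n) (x y : pt R n).

Lemma dot_le1 x y : enorm x = 1 -> enorm y = 1 -> -1 <= dot x y <= 1.
Proof.
move=> x1 y1; have e := @sphere_sqr_sum R d.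
have sq c : 0 <= \sum_i (x i + c * y i) ^+ 2 by apply: sumr_ge0 => i _; exact: sqr_ge0.
have ex c : \sum_i (x i + c * y i) ^+ 2 = 1 + c * 2 * dot x y + c ^+ 2.
  transitivity (\sum_i x i ^+ 2 + c * 2 * dot x y + c ^+ 2 * \sum_i y i ^+ 2).
    by rewrite /dot !mulr_sumr -!big_split/=; apply: eq_bigr => i _; ring.
  by rewrite !e// mulr1.
by have := sq 1; have := sq (-1); rewrite !ex; lra.
Qed.

Definition planar (s c : R) : pt R n :=
  fun i => if val i == 0 then s else if val i == 1 then c else 0.

Lemma enorm_planar s c : s ^+ 2 + c ^+ 2 = 1 -> enorm (planar s c) = 1.
Proof.
move=> sc; rewrite -(sqrtr1 R) -sc /enorm; congr Num.sqrt.
have i1 : (1 < n)%N by [].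
rewrite (bigD1 ord0)//= (bigD1 (Ordinal i1))//= [Y in _ + (_ + Y)]big1 ?addr0// => i.
by case: i => -[|[|i]] //= *; rewrite /planar/= expr0n.
Qed.

Lemma dot_planar s c : dot (planar 1 0) (planar s c) = s.
Proof.
rewrite /dot big_ord_recl /planar/= mul1r big1 ?addr0// => i _.
by rewrite if_same mul0r.
Qed.

(** Reduction modulo [c^2 = 1 - s^2] leaves a polynomial of degree at most one in [c]. *)
Lemma planar_split p : exists A B : {poly R}, forall s c, c ^+ 2 = 1 - s ^+ 2 ->
  meval (planar s c) p = A.[s] + c * B.[s].
Proof.
elim/mpoly_ring_ind: p => [a|i|p q [A [B h]] [A' [B' h']]|p q [A [B h]] [A' [B' h']]].
- by exists a%:P, 0 => s c _; rewrite mevalC hornerC horner0 mulr0 addr0.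
- case e0 : (val i == 0); first by exists 'X, 0 => s c _; rewrite mevalXU /planar e0 hornerX horner0 mulr0 addr0.
  case e1 : (val i == 1); first by exists 0, 1 => s c _; rewrite mevalXU /planar e0 e1 horner0 hornerC mulr1 add0r.
  by exists 0, 0 => s c _; rewrite mevalXU /planar e0 e1 horner0 mulr0 addr0.
- by exists (A + A'), (B + B') => s c sc; rewrite mevalD h// h'// !hornerD; ring.
- exists (A * A' + (1%:P - 'X^2) * (B * B')), (A * B' + A' * B) => s c sc.
  rewrite mevalM h// h'// !hornerE.
  have -> : (A.[s] + c * B.[s]) * (A'.[s] + c * B'.[s]) = A.[s] * A'.[s]
    + c ^+ 2 * (B.[s] * B'.[s]) + c * (A.[s] * B'.[s] + A'.[s] * B.[s]) by ring.
  by rewrite sc mulrA.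
Qed.

(** The points [(s, c)] and [(s, -c)] have the same inner product with the pole, so the part odd in
    [c] drops out and [A] alone represents the kernel. *)
Lemma ker_zonal : exists P : {poly R}, forall x y, enorm x = 1 -> enorm y = 1 ->
  ker x y = P.[dot x y].
Proof.
have [A [B AB]] := planar_split (kpoly (planar 1 0)); exists A => x y x1 y1.
set s := dot x y; have /andP[s1 s2] := dot_le1 x1 y1; rewrite -/s in s1 s2.
have sc : Num.sqrt (1 - s ^+ 2) ^+ 2 = 1 - s ^+ 2 by rewrite sqr_sqrtr//; nra.
set c := Num.sqrt _ in sc.
have e1 : ker x y = A.[s] + c * B.[s].
  rewrite -AB// -/(ker _ _); apply: ker_dot => //; last by rewrite dot_planar.
    by apply: enorm_planar; ring.
  by apply: enorm_planar; rewrite sc; ring.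
have e2 : ker x y = A.[s] + - c * B.[s].
  rewrite -AB ?sqrrN// -/(ker _ _); apply: ker_dot => //; last by rewrite dot_planar.
    by apply: enorm_planar; ring.
  by apply: enorm_planar; rewrite sqrrN sc; ring.
lra.
Qed.

(** * Rotation generators and the trace bound for the derivative at 1 *)

Definition rotD i j p : mp := XU i * mderiv j p - XU j * mderiv i p.

Lemma rotDD i j p q : rotD i j (p + q) = rotD i j p + rotD i j q.
Proof. by rewrite /rotD !mderivD; ring. Qed.

Lemma rotDZ i j c p : rotD i j (c *: p) = c *: rotD i j p.
Proof. by rewrite /rotD !mderivZ -![XU _ * _]scalerAr -scalerBr. Qed.

Lemma rotDB i j p q : rotD i j (p - q) = rotD i j p - rotD i j q.
Proof. by rewrite -scaleN1r rotDD rotDZ scaleN1r. Qed.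

Lemma rotD0 i j : rotD i j 0 = 0.
Proof. by rewrite /rotD !mderiv0 !mulr0 subrr. Qed.

Lemma rotD_sum i j (J : Type) (r : seq J) (F : J -> mp) :
  rotD i j (\sum_(a <- r) F a) = \sum_(a <- r) rotD i j (F a).
Proof. by apply: (big_morph _ (rotDD i j) (rotD0 i j)). Qed.

Lemma rotDM i j p q : rotD i j (p * q) = rotD i j p * q + p * rotD i j q.
Proof. by rewrite /rotD !mderivM; ring. Qed.

Lemma rotDC i j c : rotD i j (mpolyC n c) = 0.
Proof. by rewrite /rotD !mderivC !mulr0 subrr. Qed.

Lemma inV_rotD i j p : inV t p -> inV t (rotD i j p).
Proof.
have h k l : inV t p -> inV t (XU k * mderiv l p).
  move=> Vp; have dk : degin 1 1 (XU k : mp) by have := @deginX R d (mnm1 k); rewrite mdeg1.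
  by have := deginM dk (@degin_deriv _ _ _ _ l _ Vp); apply: deginW; lia.
by move=> Vp; apply: deginB; apply: h.
Qed.

Lemma is_derive_meval (g : R -> pt R n) (v : pt R n) (s : R) p :
  (forall k, is_derive s 1 (fun u => g u k) (v k)) ->
  is_derive s 1 (fun u => meval (g u) p) (\sum_k v k * meval (g s) (mderiv k p)).
Proof.
move=> dg; elim/mpoly_ring_ind: p => [c|i|p q IHp IHq|p q IHp IHq].
- rewrite (_ : (fun u => _) = cst c); last by apply/funext => u; rewrite mevalC.
  by apply: is_derive_eq; rewrite big1// => k _; rewrite mderivC meval0 mulr0.
- rewrite (_ : (fun u => _) = (fun u => g u i)); last by apply/funext => u; rewrite mevalXU.
  apply: is_derive_eq (dg i) _.
  rewrite (bigD1 i)//= big1 ?addr0 => [|k /negbTE ki].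
    by rewrite mderivXU eqxx meval1 mulr1.
  by rewrite mderivXU eq_sym ki meval0 mulr0.
- rewrite (_ : (fun u => _) = (fun u => meval (g u) p) + (fun u => meval (g u) q)); last first.
    by apply/funext => u; rewrite mevalD.
  apply: is_derive_eq; rewrite -big_split/=; apply: eq_bigr => k _.
  by rewrite mderivD mevalD mulrDr.
- rewrite (_ : (fun u => _) = (fun u => meval (g u) p) * (fun u => meval (g u) q)); last first.
    by apply/funext => u; rewrite mevalM.
  apply: is_derive_eq; rewrite /GRing.scale/= !mulr_sumr -big_split/=; apply: eq_bigr => k _.
  by rewrite mderivM mevalD !mevalM; ring.
Qed.

Definition rot (i j : 'I_n) x (s : R) : pt R n := fun k =>
  if k == i then cos s * x i - sin s * x j else
  if k == j then sin s * x i + cos s * x j else x k.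

Lemma enorm_rot i j x s : i != j -> enorm (rot i j x s) = enorm x.
Proof.
move=> ij; rewrite /enorm; congr Num.sqrt.
rewrite (bigD1 i)//= [in RHS](bigD1 i)//= (bigD1 j) 1?eq_sym//= [in RHS](bigD1 j) 1?eq_sym//=.
rewrite !addrA; congr (_ + _).
  rewrite /rot eqxx eq_sym (negbTE ij) eqxx.
  have := cos2Dsin2 s; set c := cos s; set e := sin s => h.
  rewrite -[RHS]mul1r -h; ring.
by apply: eq_bigr => k /andP[ki kj]; rewrite /rot (negbTE ki) (negbTE kj).
Qed.

(** The generator is the derivative at angle 0 along [rot], which stays on the sphere. Two
    polynomials that agree only on the sphere, such as [kpoly x] and its zonal form, may therefore
    be differentiated alike. *)
Lemma rotD_vanish i j p : (forall x, enorm x = 1 -> meval x p = 0) ->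
  forall x, enorm x = 1 -> meval x (rotD i j p) = 0.
Proof.
move=> p0 x x1; have [->|ij] := eqVneq i j; first by rewrite /rotD subrr meval0.
pose v : pt R n := fun k => if k == i then - x j else if k == j then x i else 0.
have r0 : rot i j x 0 = x.
  apply/funext => k; rewrite /rot cos0 sin0.
  by case: eqP => [->|_]; [ring|case: eqP => [->|_]; [ring|]].
have dv k : is_derive (0 : R) 1 (fun u => rot i j x u k) (v k).
  rewrite /rot /v; case: eqP => _; last case: eqP => _.
  - by apply: is_derive_eq; rewrite /GRing.scale/= sin0 cos0; ring.
  - by apply: is_derive_eq; rewrite /GRing.scale/= sin0 cos0; ring.
  - exact: is_derive_cst.
have := is_derive_meval p dv; rewrite r0.
rewrite (_ : (fun u => _) = cst 0); last first.
  by apply/funext => u; rewrite p0// enorm_rot.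
move=> [_]; rewrite derive_cst => /esym.
rewrite (bigD1 i)//= (bigD1 j) 1?eq_sym//= [Y in _ + (_ + Y)]big1 ?addr0; last first.
  by move=> k /andP[ki kj]; rewrite /v (negbTE ki) (negbTE kj) mul0r.
rewrite /v eqxx eq_sym (negbTE ij) eqxx => h.
by rewrite /rotD mevalB !mevalM !mevalXU; lra.
Qed.

Definition hcomp (P : {poly R}) (l : mp) : mp := (map_poly (@mpolyC n R) P).[l].

Lemma rotD_hcomp i j P l : rotD i j (hcomp P l) = hcomp P^`() l * rotD i j l.
Proof.
elim/poly_ind: P => [|P c IH].
  by rewrite /hcomp deriv0 !rmorph0 !horner0 rotD0 mul0r.
rewrite /hcomp derivD derivM derivX derivC addr0 mulr1.
rewrite !rmorphD !rmorphM/= map_polyX map_polyC/= !hornerE rotDD rotDM rotDC addr0.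
rewrite -/(hcomp _ _) IH /hcomp; ring.
Qed.

Lemma meval_hcomp P l x : meval x (hcomp P l) = P.[meval x l].
Proof.
elim/poly_ind: P => [|P c IH]; first by rewrite /hcomp rmorph0 !horner0 meval0.
rewrite /hcomp rmorphD rmorphM/= map_polyX map_polyC/= !hornerE mevalD mevalM mevalC.
by rewrite -/(hcomp _ _) IH.
Qed.

Definition lform x : mp := \sum_k x k *: XU k.

Lemma meval_lform x y : meval y (lform x) = dot x y.
Proof. by rewrite raddf_sum/=; apply: eq_bigr => k _; rewrite mevalZ mevalXU. Qed.

Lemma mderiv_lform x k : mderiv k (lform x) = mpolyC n (x k).
Proof.
rewrite raddf_sum/= (bigD1 k)//= big1 ?addr0 => [|l /negbTE lk].
  by rewrite mderivZ mderivXU eqxx -mul_mpolyC mulr1.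
by rewrite mderivZ mderivXU lk scaler0.
Qed.

Lemma rotD_lform i j x : rotD i j (lform x) = x j *: XU i - x i *: XU j.
Proof. by rewrite /rotD !mderiv_lform ![XU _ * _]mulrC !mul_mpolyC. Qed.

Lemma rotD_XU i j k : rotD i j (XU k) = (k == j)%:R * XU i - (k == i)%:R * XU j.
Proof. by rewrite /rotD !mderivXU ![XU _ * _]mulrC. Qed.

(** With [l = <x, .>], applying the generator twice to [P(l)] gives
    [P''(l) (rotD l)^2 + P'(l) rotD (rotD l)]. At the point [x] itself [rotD l] is 0 and the second
    generator of [l] is [-(x_i^2 + x_j^2)]. *)
Lemma rotD2_kpoly (P : {poly R}) i j x : i != j ->
  (forall x y, enorm x = 1 -> enorm y = 1 -> ker x y = P.[dot x y]) ->
  enorm x = 1 ->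
  meval x (rotD i j (rotD i j (kpoly x))) = - P^`().[1] * (x i ^+ 2 + x j ^+ 2).
Proof.
move=> ij kP x1.
have v0 y : enorm y = 1 -> meval y (kpoly x - hcomp P (lform x)) = 0.
  by move=> y1; rewrite mevalB meval_hcomp meval_lform -kP// subrr.
have := rotD_vanish i j (rotD_vanish i j v0) x1.
rewrite (rotDB i j (kpoly x)) (rotDB i j (rotD i j (kpoly x))) mevalB => /eqP; rewrite subr_eq0 => /eqP ->.
rewrite rotD_hcomp rotDM rotD_hcomp mevalD !mevalM !meval_hcomp.
have -> : meval x (rotD i j (lform x)) = 0.
  by rewrite rotD_lform mevalB !mevalZ !mevalXU; ring.
have -> : meval x (lform x) = 1 by rewrite meval_lform dotxx x1 expr1n.
rewrite !(mulr0, mul0r) add0r rotD_lform rotDB !rotDZ !rotD_XU !eqxx (negbTE ij) eq_sym (negbTE ij).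
rewrite !mul0r !mul1r sub0r subr0 mevalB !mevalZ mevalN !mevalXU; ring.
Qed.

(** Expanding each image in the basis produces [igram] times [gram], so averaging over the diagonal
    of the kernel computes the trace of [T]. *)
Lemma trace_V (T : mp -> mp) :
  (forall p, inV t p -> inV t (T p)) ->
  smean (\sum_a (\sum_b igram a b *: X (bmono b)) * T (X (bmono a))) =
  \sum_a mcoeff (bmono a) (T (X (bmono a))).
Proof.
move=> VT; rewrite linear_sum/=; apply: eq_bigr => a _.
rewrite {1}(inVE t0 (VT _ (@inV_bmono R d t t0 a))) mulr_sumr linear_sum/=.
transitivity (\sum_c mcoeff (bmono c) (T (X (bmono a))) * \sum_b igram a b * gram R d t b c).
  apply: eq_bigr => c _; rewrite -[_ * (_ *: _)]scalerAr smeanZ; congr (_ * _).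
  rewrite mulr_suml linear_sum/=; apply: eq_bigr => b _.
  by rewrite -scalerAl smeanZ mxE.
rewrite (bigD1 a)//= [Y in _ + Y]big1 ?addr0 => [|c /negbTE ca].
  by rewrite igram_gram// eqxx mulr1.
by rewrite igram_gram// eq_sym ca mulr0.
Qed.

Lemma meval_trace i j x :
  meval x (\sum_a (\sum_b igram a b *: X (bmono b)) * rotD i j (rotD i j (X (bmono a)))) =
  meval x (rotD i j (rotD i j (kpoly x))).
Proof.
rewrite /kpoly !rotD_sum !raddf_sum/=; apply: eq_bigr => a _.
rewrite !rotDZ mevalZ mevalM; congr (_ * _); rewrite raddf_sum/=.
by apply: eq_bigr => b _; rewrite mevalZ.
Qed.

Lemma mulXU_mderiv i m : XU i * mderiv i (X m) = (m i)%:R *: X m.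
Proof.
rewrite mderivX -scalerAr; case mi: (m i) => [|k]; first by rewrite !scale0r.
congr (_ *: _); rewrite -mpolyXD; congr (X _); apply/mnmP => j.
by rewrite mnmDE mnmBE mnm1E; case: eqP => [<-|_] /=; lia.
Qed.

Lemma mcoeff_rotD_XU i j m : i != j ->
  mcoeff (m +U j) (rotD i j (XU i * X m)) = - (m i).+1%:R.
Proof.
move=> ij; rewrite /rotD !mderivM !mderivXU eqxx (negbTE ij) mul0r add0r mul1r.
rewrite mulXU_mderiv [XU j * _]mulrDr mderivX.
rewrite -!scalerAr mcoeffB mcoeffD !mcoeffZ -!mpolyXD !mcoeffX.
rewrite (addmC (mnm1 j)) eqxx mulr1.
have -> : (mnm_add (mnm1 i) (mnm_add (mnm1 i) (mnm_sub m (mnm1 j))) == m +U j) = false.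
  apply/negbTE/eqP => /mnmP/(_ i); rewrite !mnmDE mnmBE !mnm1E eqxx eq_sym (negbTE ij)/=; lia.
by rewrite mulr0 sub0r -natr1 addrC.
Qed.

(** The generator moves one unit of exponent between [i] and [j], in either direction; the two round
    trips are what returns to [m]. *)
Lemma mcoeff_rotD2 i j m : i != j ->
  mcoeff m (rotD i j (rotD i j (X m))) = - (m j * (m i).+1 + m i * (m j).+1)%:R.
Proof.
have main k l : k != l -> mcoeff m (rotD k l (XU k * mderiv l (X m))) = - (m l * (m k).+1)%:R.
  move=> kl; rewrite mderivX -[XU k * _]scalerAr rotDZ mcoeffZ.
  case ml: (m l) => [|c]; first by rewrite mul0r oppr0.
  set m' := mnm_sub m (mnm1 l).
  have mE : m = m' +U l.
    by apply/mnmP => j'; rewrite mnmDE mnmBE mnm1E; case: eqP => [<-|_] /=; lia.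
  rewrite {1}mE mcoeff_rotD_XU// mulrN -natrM; congr (- (_ * _)%:R); congr _.+1.
  by rewrite mnmBE mnm1E eq_sym (negbTE kl) subn0.
move=> ij; rewrite {2}/rotD rotDB mcoeffB main//.
have -> : rotD i j (XU j * mderiv i (X m)) = - rotD j i (XU j * mderiv i (X m)).
  by rewrite /rotD opprB.
by rewrite mcoeffN main 1?eq_sym// natrD; ring.
Qed.

(** With [k = mdeg m] the sum equals [2 k^2 + 2 d k] minus twice the sum of the [m_i^2]. Since
    [m_i^2 >= m_i], it is at most [2 k (k + d - 1)], which grows with [k]. *)
Lemma sum_pairs_mono m : (mdeg m <= t)%N ->
  (\sum_i \sum_(j | j != i) (m j * (m i).+1 + m i * (m j).+1) <= 2 * (t * t + d.-1 * t))%N.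
Proof.
move=> mt; set k := mdeg m in mt.
have kE i : (\sum_(j | j != i) m j = k - m i)%N.
  by rewrite /k mdegE [in RHS](bigD1 i)//= addKn.
have ki i : (m i <= k)%N by rewrite /k mdegE (bigD1 i)//= leq_addr.
have sI i : (\sum_(j | j != i) (m j * (m i).+1 + m i * (m j).+1) =
    (k - m i) * (m i).+1 + m i * (k - m i) + m i * d)%N.
  rewrite big_split/= -big_distrl/= kE -addnA; congr (_ + _)%N.
  under eq_bigr do rewrite mulnS addnC.
  rewrite big_split/= -big_distrr/= kE; congr (_ + _)%N.
  by rewrite sum_nat_const cardC1 card_ord mulnC.
rewrite (eq_bigr _ (fun i _ => sI i)).
(* This amounts to [a^2 >= a] and makes the bound linear in [m i], ready for summation. The
   truncated [2 * k + d - 3] is harmless: it is a true difference once [k > 0], and otherwise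
   [m i = 0]. *)
have le i : ((k - m i) * (m i).+1 + m i * (k - m i) + m i * d <=
    k + m i * (2 * k + d - 3))%N.
  have := ki i; move: (m i) => a /subnKC <-; move: (k - a)%N => b.
  rewrite addKn; case: a => [|a]; first lia.
  have -> : (2 * (a.+1 + b) + d - 3 = 2 * a + 2 * b + d.-1)%N by lia.
  by rewrite -{1}(prednK d0); nia.
apply: leq_trans (leq_sum _ (fun i _ => le i)) _.
rewrite big_split/= sum_nat_const card_ord -big_distrl/= -mdegE -/k.
case: (posnP k) => [->|k0]; first by rewrite muln0 mul0n.
have -> : (2 * k + d - 3 = 2 * k.-1 + d.-1)%N by lia.
by rewrite -{1}(prednK d0) -{2}(prednK k0); nia.
Qed.

Lemma zonal_deriv_bound (P : {poly R}) :
  (forall x y, enorm x = 1 -> enorm y = 1 -> ker x y = P.[dot x y]) ->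
  d%:R * P^`().[1] <= N%:R * (t * t + d.-1 * t)%:R.
Proof.
move=> kP.
pose F i j : mp := \sum_a (\sum_b igram a b *: X (bmono b)) * rotD i j (rotD i j (X (bmono a))).
(* On the sphere each square [x_i^2] occurs [2 d] times in the sum over ordered pairs, and the
   squares add up to 1. *)
have e1 : smean (\sum_i \sum_(j | j != i) F i j) = - (2 * d%:R * P^`().[1]).
  transitivity (smean (mpolyC n (- (2 * d%:R * P^`().[1])))); last first.
    by rewrite -[mpolyC _ _]mulr1 mul_mpolyC smeanZ smean1 mulr1.
  apply: eq_smean => x x1; rewrite mevalC raddf_sum/=.
  have s1 := sphere_sqr_sum x1.
  transitivity (\sum_i (- P^`().[1] * (d%:R * x i ^+ 2 + (1 - x i ^+ 2)))).
    apply: eq_bigr => i _; rewrite raddf_sum/=.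
    transitivity (\sum_(j | j != i) (- P^`().[1] * (x i ^+ 2 + x j ^+ 2))).
      by apply: eq_bigr => j ji; rewrite meval_trace (rotD2_kpoly (P := P))// eq_sym.
    rewrite -mulr_sumr big_split/= sumr_const cardC1 card_ord/=.
    have -> : \sum_(j | j != i) x j ^+ 2 = 1 - x i ^+ 2.
      by have := s1; rewrite (bigD1 i)//=; lra.
    by rewrite mulr_natl.
  rewrite -mulr_sumr big_split/= -mulr_sumr sumrB s1 sumr_const card_ord.
  by rewrite -natr1; ring.
have e2 : smean (\sum_i \sum_(j | j != i) F i j) = - (\sum_a
    \sum_i \sum_(j | j != i) (bmono a j * (bmono a i).+1 + bmono a i * (bmono a j).+1))%:R.
  rewrite linear_sum/= natr_sum -sumrN.
  transitivity (\sum_i \sum_(j | j != i) \sum_a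
     - (bmono a j * (bmono a i).+1 + bmono a i * (bmono a j).+1)%:R : R).
    apply: eq_bigr => i _; rewrite linear_sum/=; apply: eq_bigr => j ji.
    rewrite (@trace_V (fun p => rotD i j (rotD i j p))); last first.
      by move=> p Vp; do 2 apply: inV_rotD.
    by apply: eq_bigr => a _; rewrite mcoeff_rotD2// eq_sym.
  under eq_bigr do rewrite exchange_big/=.
  rewrite exchange_big/=; apply: eq_bigr => a _.
  rewrite natr_sum -sumrN; apply: eq_bigr => i _.
  by rewrite natr_sum -sumrN.
have le : ((\sum_a \sum_i \sum_(j | j != i) (bmono a j * (bmono a i).+1 + bmono a i * (bmono a j).+1))
    <= N * (2 * (t * t + d.-1 * t)))%N.
  rewrite -[N in leqRHS]card_ord -sum_nat_const; apply: leq_sum => a _.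
  by apply: sum_pairs_mono; have /andP[] := mdeg_bmono t0 a.
move: le; rewrite -(ler_nat R) natrM (natrM _ 2); move: e1; rewrite e2; lra.
Qed.

End Zonal.

(** * Curves *)

Section Curve.
Variable R : realType.

Lemma dot_cauchy_schwarz k (x y : pt R k.+1) : dot x y ^+ 2 <= dot x x * dot y y.
Proof.
have yy0 : 0 <= dot y y by rewrite dotxx sqr_ge0.
have [y0|yn0] := eqVneq (dot y y) 0.
  rewrite y0 mulr0; suff -> : dot x y = 0 by rewrite expr0n.
  by apply: big1 => i _; rewrite (dotxx_eq0 y0) mulr0.
have yy : 0 < dot y y by rewrite lt_def yn0.
pose z : pt R k.+1 := fun i => dot y y * x i - dot x y * y i.
have dl (c : R) (u v : pt R k.+1) : dot (fun j => c * u j) v = c * dot u v.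
  by rewrite /dot mulr_sumr; apply: eq_bigr => i _; rewrite mulrA.
have dr (c : R) (u v : pt R k.+1) : dot v (fun j => c * u j) = c * dot v u.
  by rewrite dotC dl dotC.
have : 0 <= dot z z by rewrite dotxx sqr_ge0.
have -> : dot z z = dot y y * (dot y y * dot x x - dot x y ^+ 2).
  rewrite /z (dotBZl (fun i => dot y y * x i)) !(dotBZr (fun i => dot y y * x i)).
  by rewrite !dl !dr (dotC y x); ring.
by rewrite pmulr_rge0// subr_ge0 mulrC.
Qed.

Definition lip_on (f : R -> R) (C a b : R) :=
  forall x y, a <= x -> x <= y -> y <= b -> `|f y - f x| <= C * (y - x).

Lemma lip_on_piece (f df : R -> R) C a b : a < b ->
  {within `[a, b]%classic, continuous f} ->
  (forall u, u \in `]a, b[ -> is_derive u 1 f (df u)) ->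
  (forall u, u \in `]a, b[ -> `|df u| <= C) -> lip_on f C a b.
Proof.
move=> ab cf dfd dfC x y ax xy yb.
move: xy; rewrite le_eqVlt => /predU1P[->|xy]; first by rewrite !subrr normr0 mulr0.
have sub u : u \in `]x, y[ -> u \in `]a, b[.
  by rewrite !in_itv/= => /andP[? ?]; apply/andP; split; lra.
have dxy u : u \in `]x, y[ -> is_derive u 1 f (df u) by move=> /sub/dfd.
have cxy : {within `[x, y]%classic, continuous f}.
  apply: continuous_subspaceW cf => u /=; rewrite !in_itv/= => /andP[? ?].
  by apply/andP; split; lra.
have [c cI ->] := MVT xy dxy cxy.
have yx0 : 0 < y - x by rewrite subr_gt0.
by rewrite normrM (gtr0_norm yx0) ler_pM2r//; apply/dfC/sub.
Qed.

Lemma lip_on_cat f C a b c : lip_on f C a b -> lip_on f C b c -> lip_on f C a c.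
Proof.
move=> h1 h2 x y ax xy yc; have [yb|by_] := leP y b; first exact: h1.
have [bx|xb] := leP b x; first exact: h2.
have := h1 x b ax (ltW xb) (lexx b); have := h2 b y (lexx b) (ltW by_) yc.
have := ler_normD (f y - f b) (f b - f x); rewrite addrA subrK; lra.
Qed.

Lemma lip_on_partition (f df : R -> R) C (s : seq R) a b :
  sorted <%R (a :: rcons s b) ->
  {within `[a, b]%classic, continuous f} ->
  (forall ab, ab \in zip (a :: rcons s b) (rcons s b) -> forall u, u \in `]ab.1, ab.2[ ->
     is_derive u 1 f (df u) /\ `|df u| <= C) ->
  lip_on f C a b.
Proof.
elim: s a => [|c s IH] a /= so cf dC.
  move: so; rewrite andbT => so.
  have h u : u \in `]a, b[ -> is_derive u 1 f (df u) /\ `|df u| <= C.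
    by apply: (dC (a, b)); rewrite inE.
  apply: (lip_on_piece (df := df) so cf) => u uab; exact: (h u uab).1 || exact: (h u uab).2.
move: so => /andP[ac so].
have cb : c < b.
  by have := order_path_min lt_trans so; rewrite all_rcons => /andP[].
apply: (@lip_on_cat _ _ _ c).
  apply: (lip_on_piece (df := df) ac) => [|u uac|u uac].
  - by apply: continuous_subspaceW cf; apply: subset_itvl; rewrite bnd_simp ltW.
  - exact: (dC (a, c) (mem_head _ _) u uac).1.
  - exact: (dC (a, c) (mem_head _ _) u uac).2.
apply: IH => //.
  by apply: continuous_subspaceW cf; apply: subset_itvr; rewrite bnd_simp ltW.
by move=> ab' h; apply: dC; rewrite inE h orbT.
Qed.

Lemma continuous_within_sum (J : Type) (r : seq J) (A : set R) (F : J -> R -> R) :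
  (forall j, {within A, continuous (F j)}) ->
  {within A, continuous (fun u => \sum_(j <- r) F j u)}.
Proof.
move=> cF; elim: r => [|j r IH].
  by rewrite (_ : (fun u => _) = cst 0); [move=> x; exact: cvg_cst|
    apply/funext => u; rewrite big_nil].
rewrite (_ : (fun u => _) = (fun u => F j u + \sum_(j <- r) F j u)); last first.
  by apply/funext => u; rewrite big_cons.
by move=> x; apply: continuousD; [exact: cF|exact: IH].
Qed.

Lemma continuous_withinM (A : set R) (f g : R -> R) :
  {within A, continuous f} -> {within A, continuous g} ->
  {within A, continuous (fun u => f u * g u)}.
Proof. by move=> cf cg x; apply: (continuousM (cf x) (cg x)). Qed.

(** Project on the chord [e]: unit speed and Cauchy-Schwarz make [<e, gam w>] Lipschitz with
    constant [|e|], while its increment from [u] to [v] is [|e|^2]. Dividing by [|e|] gives the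
    claim. *)
Lemma curve_chord d (gam : R -> pt R d.+1) L u v : arclength_curve gam L ->
  0 <= u -> u <= v -> v <= L ->
  \sum_i (gam v i - gam u i) ^+ 2 <= (v - u) ^+ 2.
Proof.
move=> [L0 [_ [_ [cg [s [so pc]]]]]] u0 uv vL.
pose e : pt R d.+1 := fun i => gam v i - gam u i.
set q := \sum_i _; have qE : q = dot e e by apply: eq_bigr => i _; rewrite expr2.
have q0 : 0 <= q by apply: sumr_ge0 => i _; exact: sqr_ge0.
pose f w := \sum_i e i * gam w i.
pose df w := \sum_i e i * derive1 (fun v => gam v i) w.
have lip : lip_on f (Num.sqrt q) 0 L.
  apply: (lip_on_partition (df := df) so) => [|ab abP w wab].
    apply: continuous_within_sum => i; apply: continuous_withinM; last exact: cg.
    by move=> x; exact: cvg_cst.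
  have [C1 sp] := pc ab abP; split.
    have dg i : is_derive w 1 (fun v => gam v i) (derive1 (fun v => gam v i) w).
      by rewrite derive1E; apply/derivableP; case: (C1 i) => + _; apply.
    rewrite /f (_ : (fun w => _) = \sum_i (fun w => e i * gam w i)); last first.
      by apply/funext => x; rewrite fct_sumE.
    apply: is_derive_eq.
    by apply: eq_bigr => i _; rewrite /GRing.scale/=.
  rewrite -sqrtr_sqr ler_sqrt//.
  have := dot_cauchy_schwarz e (fun i => derive1 (fun v => gam v i) w).
  rewrite -qE [X in _ <= q * X](_ : _ = 1) ?mulr1//.
  by rewrite -(sp w wab); apply: eq_bigr => i _; rewrite expr2.
have := lip u v u0 uv vL.
have -> : f v - f u = q.
  by rewrite qE /f -sumrB; apply: eq_bigr => i _; rewrite -mulrBr.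
rewrite ger0_norm//; have := sqr_sqrtr q0; have := sqrtr_ge0 q.
move: (Num.sqrt q) => r r0 <- h; have [->|rn] := eqVneq r 0.
  by rewrite expr0n/= sqr_ge0.
have rp : 0 < r by rewrite lt_def rn.
by move: h; rewrite expr2 ler_pM2l// => h; rewrite ler_sqr// nnegrE; lra.
Qed.

Lemma horner_bounded (Q : {poly R}) : exists2 C, 0 <= C &
  forall s, -1 <= s <= 1 -> `|Q.[s]| <= C.
Proof.
exists (\sum_(i < size Q) `|Q`_i|) => [|s s1]; first exact: sumr_ge0.
rewrite horner_coef; apply: (le_trans (ler_norm_sum _ _ _)); apply: ler_sum => i _.
rewrite normrM ler_piMr// normrX exprn_ile1// ler_norml; lra.
Qed.

(** Dividing by [X - 1] twice gives the expansion exactly; the second quotient is bounded on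
    [[-1, 1]]. *)
Lemma poly_taylor1 (P : {poly R}) : exists2 C, 0 <= C & forall s, -1 <= s <= 1 ->
  P.[1] - P.[s] <= P^`().[1] * (1 - s) + C * (1 - s) ^+ 2.
Proof.
have [Q1 hQ1] : exists Q, P - P.[1]%:P = Q * ('X - 1%:P).
  by apply/factor_theorem; rewrite /root !hornerE subrr.
have [Q2 hQ2] : exists Q, Q1 - Q1.[1]%:P = Q * ('X - 1%:P).
  by apply/factor_theorem; rewrite /root !hornerE subrr.
have PE : P = P.[1]%:P + Q1 * ('X - 1%:P) by rewrite -hQ1 addrC subrK.
have Q1E : Q1 = Q1.[1]%:P + Q2 * ('X - 1%:P) by rewrite -hQ2 addrC subrK.
have dP : P^`().[1] = Q1.[1].
  rewrite {1}PE derivD derivC add0r derivM derivXsubC mulr1 hornerD hornerM hornerXsubC.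
  by rewrite subrr mulr0 add0r.
have [C C0 hC] := horner_bounded Q2; exists C => // s s1.
have -> : P.[s] = P.[1] + (Q1.[1] + Q2.[s] * (s - 1)) * (s - 1).
  have -> : Q1.[1] + Q2.[s] * (s - 1) = Q1.[s].
    by rewrite {2}Q1E hornerD hornerC hornerM hornerXsubC.
  by rewrite {1}PE hornerD hornerC hornerM hornerXsubC.
have := hC s s1; rewrite ler_norml => /andP[h1 h2].
have := sqr_ge0 (1 - s); rewrite dP; nra.
Qed.

Lemma sum_sqr_le (m : nat) (a : 'I_m -> R) :
  (\sum_k a k) ^+ 2 <= m%:R * \sum_k a k ^+ 2.
Proof.
have : 0 <= \sum_k \sum_l (a k - a l) ^+ 2.
  by do 2 apply: sumr_ge0 => ? _; exact: sqr_ge0.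
have cE (c : R) : \sum_(l < m) c = m%:R * c by rewrite sumr_const card_ord mulr_natl.
have -> : \sum_k \sum_l (a k - a l) ^+ 2 =
    2 * (m%:R * \sum_k a k ^+ 2) - 2 * (\sum_k a k) ^+ 2.
  transitivity (\sum_k (m%:R * a k ^+ 2 + \sum_l a l ^+ 2 - 2 * a k * \sum_l a l)).
    apply: eq_bigr => k _.
    by rewrite -cE mulr_sumr -big_split/= -sumrB; apply: eq_bigr => l _; ring.
  by rewrite sumrB big_split/= -mulr_sumr cE -mulr_suml -mulr_sumr; ring.
lra.
Qed.

End Curve.

(** * Lower bound for the kernel along a curve *)

Section KernelOnCurve.
Variables (R : realType) (d t : nat).
Hypotheses (d0 : (0 < d)%N) (htd : (d <= t)%N).
Local Notation n := d.+1.
Local Notation mp := (mpoly n R).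
Local Notation smean := (@smean R d).
Local Notation N := (dimPi d t).
Local Notation ker := (@ker R d t).
Local Notation kpoly := (@kpoly R d t).

Let t0 : (0 < t)%N := leq_trans d0 htd.

Lemma dimPi_gt0 : (0 < N)%N.
Proof. by rewrite /dimPi addn_gt0 bin_gt0 leq_addl. Qed.

Lemma smean_sum_sqr_le m (f : 'I_m -> mp) :
  smean ((\sum_k f k) * (\sum_k f k)) <= m%:R * \sum_k smean (f k * f k).
Proof.
rewrite -subr_ge0 -linear_sum/= -smeanZ -linearB/=; apply: sphere_int_ge0 => x _.
rewrite mevalB mevalZ mevalM !raddf_sum/= -expr2.
under eq_bigr do rewrite mevalM -expr2.
by rewrite subr_ge0 sum_sqr_le.
Qed.

Lemma smean_kpoly_diff (x y : pt R n) : enorm x = 1 -> enorm y = 1 ->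
  smean ((kpoly x - kpoly y) * (kpoly x - kpoly y)) = 2 * (N%:R - ker x y).
Proof.
move=> x1 y1; rewrite mulrBl !mulrBr !linearB/= -!kerE// !ker_diag// (ker_sym t0 y x).
ring.
Qed.

Lemma dist_sqr (x y : pt R n) : enorm x = 1 -> enorm y = 1 ->
  \sum_i (y i - x i) ^+ 2 = 2 * (1 - dot x y).
Proof.
move=> x1 y1; transitivity (\sum_i y i ^+ 2 + \sum_i x i ^+ 2 - 2 * dot x y).
  by rewrite /dot mulr_sumr -big_split/= -sumrB; apply: eq_bigr => i _; ring.
by rewrite !sphere_sqr_sum//; ring.
Qed.

(** The squared norm of a sum of [m] differences is at most [m] times the sum of their squared
    norms. For one step, [1 - s] is half the squared chord, so [2 (P(1) - P(s))] is at most
    [P'(1) h^2 + (C/2) h^4]. The constant is chosen before the chain, so that the steps can be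
    refined afterwards. *)
Lemma ker_chain : exists2 C : R, 0 <= C & forall (x : nat -> pt R n) m h,
  (forall k, (k <= m)%N -> enorm (x k) = 1) ->
  (forall k, (k < m)%N -> \sum_i (x k.+1 i - x k i) ^+ 2 <= h ^+ 2) ->
  2 * (N%:R - ker (x 0%N) (x m)) <=
    (m%:R * h) ^+ 2 * (N%:R * (t%:R ^+ 2 + (d%:R - 1) * t%:R) / d%:R + C * h ^+ 2).
Proof.
have [P kP] := ker_zonal R t0 d0; have Pb := zonal_deriv_bound t0 d0 kP.
have [C C0 tay] := poly_taylor1 P.
have dp : (0 : R) < d%:R by rewrite ltr0n.
set M := N%:R * _ / _.
have M0 : 0 <= M.
  rewrite /M divr_ge0// mulr_ge0// addr_ge0 ?sqr_ge0// mulr_ge0//.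
  by rewrite subr_ge0 ler1n.
have PM : P^`().[1] <= M.
  rewrite /M ler_pdivlMr// mulrC; apply: (le_trans Pb); rewrite ler_wpM2l//.
  by rewrite natrD !natrM expr2 -subn1 natrB.
exists (C / 2) => [|x m h xn xh]; first by rewrite divr_ge0.
rewrite -smean_kpoly_diff ?xn//.
have step (k : 'I_m) : smean ((kpoly (x k) - kpoly (x k.+1)) * (kpoly (x k) - kpoly (x k.+1))) <=
    M * h ^+ 2 + C / 2 * h ^+ 4.
  have x1 := xn k (ltnW (ltn_ord k)); have x2 := xn k.+1 (ltn_ord k).
  rewrite smean_kpoly_diff// kP//; have := xh k (ltn_ord k); rewrite dist_sqr//.
  have dd := dot_le1 x1 x2; have := tay _ dd.
  have -> : P.[1] = N%:R.
    by rewrite -(ker_diag t0 d0 x1) kP// dotxx x1 expr1n.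
  move: dd; set s := dot _ _ => dd h1 h2; set e := 1 - s in h1 h2.
  have e0 : 0 <= e by rewrite /e; lra.
  have h4 : h ^+ 4 = h ^+ 2 * h ^+ 2 by rewrite -exprD.
  have p1 : P^`().[1] * e <= M * e by rewrite ler_wpM2r.
  have p2 : M * (2 * e) <= M * h ^+ 2 by rewrite ler_wpM2l.
  have p3 : C / 2 * (2 * e * (2 * e)) <= C / 2 * (h ^+ 2 * h ^+ 2).
    by rewrite ler_wpM2l ?divr_ge0// ler_pM// mulr_ge0.
  rewrite h4; move: h1 p1 p2 p3; rewrite expr2; lra.
have -> : kpoly (x 0%N) - kpoly (x m) = \sum_(k < m) (kpoly (x k) - kpoly (x k.+1)).
  rewrite -(big_mkord xpredT (fun k => kpoly (x k) - kpoly (x k.+1))).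
  under eq_bigr do rewrite -opprB.
  by rewrite sumrN (telescope_sumr (fun k => kpoly (x k)))// opprB.
apply: (le_trans (smean_sum_sqr_le _)).
apply: (@le_trans _ _ (m%:R * \sum_(k < m) (M * h ^+ 2 + C / 2 * h ^+ 4))).
  by rewrite ler_wpM2l//; apply: ler_sum => k _; exact: step.
rewrite sumr_const card_ord -mulr_natl le_eqVlt; apply/orP; left; apply/eqP.
ring.
Qed.

Lemma ker_curve_le (gam : R -> pt R n) L u v : arclength_curve gam L ->
  0 <= u -> u <= v -> v <= L ->
  N%:R * (1 - t%:R ^+ 2 / d%:R * (v - u) ^+ 2) <= ker (gam u) (gam v).
Proof.
move=> cg u0 uv vL; have [C C0 chain] := ker_chain.
have [_ [gn _]] := cg.
have dp : (0 : R) < d%:R by rewrite ltr0n.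
have tp : (0 : R) < t%:R by rewrite ltr0n.
have Np : (0 : R) < N%:R by rewrite ltr0n dimPi_gt0.
(* The affordable remainder [q]: [t^2 + (d-1) t] plus [t] is [t^2 + d t], at most [2 t^2] as
   [d <= t]. The number [m.+1] of steps is then taken so large that [C h^2 <= q]. *)
have q0 : 0 < N%:R * t%:R / d%:R :> R by rewrite divr_gt0// mulr_gt0.
set q := _ / d%:R in q0.
have [m mC] : exists m : nat, C * (v - u) ^+ 2 / q <= m.+1%:R.
  exists (Num.truncn (C * (v - u) ^+ 2 / q)).
  by rewrite ltW// truncnS_gt.
set h := (v - u) / m.+1%:R.
have mp0 : (0 : R) < m.+1%:R by rewrite ltr0n.
have mh : m.+1%:R * h = v - u by rewrite /h mulrC divfK// gt_eqF.
have h0 : 0 <= h by rewrite /h divr_ge0// subr_ge0.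
pose x k := gam (u + k%:R * h).
have ux k : (k <= m.+1)%N -> 0 <= u + k%:R * h /\ u + k%:R * h <= L.
  move=> km; have k0 : 0 <= k%:R * h by rewrite mulr_ge0.
  have : k%:R * h <= m.+1%:R * h by rewrite ler_wpM2r// ler_nat.
  rewrite mh; split; lra.
have xn k : (k <= m.+1)%N -> enorm (x k) = 1.
  by move=> /ux[? ?]; apply: gn; rewrite in_itv/=; apply/andP.
have xh k : (k < m.+1)%N -> \sum_i (x k.+1 i - x k i) ^+ 2 <= h ^+ 2.
  move=> km; have [a1 a2] := ux k (ltnW km); have [b1 b2] := ux k.+1 km.
  have e : u + k.+1%:R * h - (u + k%:R * h) = h by rewrite -natr1; ring.
  rewrite -[in leRHS]e; apply: (curve_chord cg) => //; rewrite -subr_ge0 e//.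
have := chain x m.+1 h xn xh; rewrite /x mul0r addr0 mh (addrC u) subrK.
have hC : C * h ^+ 2 <= q.
  have hq : C * (v - u) ^+ 2 <= m.+1%:R * q by rewrite -ler_pdivrMr.
  have -> : C * h ^+ 2 = C * (v - u) ^+ 2 / m.+1%:R / m.+1%:R.
    by rewrite /h; field; rewrite gt_eqF.
  have m1 : 1 <= m.+1%:R :> R by rewrite ler1n.
  rewrite !ler_pdivrMr//; apply: (le_trans hq); nra.
move=> main.
have dt : d%:R <= t%:R :> R by rewrite ler_nat.
have le2 : N%:R * (t%:R ^+ 2 + (d%:R - 1) * t%:R) / d%:R + C * h ^+ 2 <=
    2 * (N%:R * (t%:R ^+ 2 / d%:R)).
  have -> : 2 * (N%:R * (t%:R ^+ 2 / d%:R)) = N%:R * (t%:R ^+ 2 + (d%:R - 1) * t%:R) / d%:R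
     + q + N%:R / d%:R * (t%:R * (t%:R - d%:R)) by rewrite /q; field; rewrite gt_eqF.
  have : 0 <= N%:R / d%:R * (t%:R * (t%:R - d%:R)) :> R.
    by rewrite mulr_ge0 ?divr_ge0// mulr_ge0// subr_ge0.
  by lra.
have := ler_wpM2l (sqr_ge0 (v - u)) le2; move: main; lra.
Qed.

Lemma ker_curve (gam : R -> pt R n) L u v : arclength_curve gam L ->
  0 <= u <= L -> 0 <= v <= L ->
  N%:R * (1 - t%:R ^+ 2 / d%:R * (v - u) ^+ 2) <= ker (gam u) (gam v).
Proof.
move=> cg /andP[u0 uL] /andP[v0 vL]; have [uv|/ltW vu] := leP u v.
  exact: (ker_curve_le cg).
rewrite (ker_sym t0) -[(v - u) ^+ 2]sqrrN opprB; exact: (ker_curve_le cg).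
Qed.

End KernelOnCurve.

(** * Test polynomials: membership in [in_Pi], bounds, powers of linear forms *)

Section PolynomialsOnSphere.
Variables (R : realType) (d : nat).
Local Notation n := d.+1.
Local Notation mp := (mpoly n R).
Local Notation smean := (@smean R d).
Local Notation X m := (mpolyX R m).
Implicit Types (p q : mp) (x : pt R n).

Lemma in_Pi_meval t p : degin 0 t p -> @in_Pi R d t (fun x => meval x p).
Proof.
apply: (@degin_ind R d 0 t (fun p => @in_Pi R d t (fun x => meval x p))) => [|q r|c m mt].
- by exists [ffun=> 0] => x; rewrite meval0 big1// => al _; rewrite ffunE mul0r.
- move=> [cq hq] [cr hr]; exists [ffun al => cq al + cr al] => x.
  rewrite mevalD hq hr -big_split/=; apply: eq_bigr => al _.
  by rewrite ffunE mulrDl.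
- pose al0 : {ffun 'I_n -> 'I_t.+1} := [ffun i => inord (m i)].
  have mi i : (m i < t.+1)%N.
    by rewrite ltnS; apply: leq_trans (andP mt).2; rewrite mdegE (bigD1 i)//= leq_addr.
  have al0E i : al0 i = m i :> nat by rewrite ffunE inordK.
  exists [ffun al => c * (al == al0)%:R] => x.
  rewrite (bigD1 al0)/=; last by rewrite (eq_bigr _ (fun i _ => al0E i)) -mdegE (andP mt).2.
  rewrite [Y in _ + Y]big1 ?addr0 => [|al /andP[_ /negbTE e]]; last first.
    by rewrite ffunE e mulr0 mul0r.
  rewrite ffunE eqxx mulr1 mevalZ mevalX; congr (_ * _).
  by apply: eq_bigr => i _; rewrite al0E.
Qed.

Lemma L2sq_meval p : L2sq (fun x : pt R n => meval x p) = smean (p * p).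
Proof. by apply: eq_sphere_int => x _; rewrite mevalM expr2. Qed.

Lemma meval_bounded p : exists2 B : R, 0 <= B & forall x, enorm x = 1 -> `|meval x p| <= B.
Proof.
exists (\sum_(m <- msupp p) `|mcoeff m p|) => [|x x1]; first exact: sumr_ge0.
rewrite mevalE; apply: (le_trans (ler_norm_sum _ _ _)); apply: ler_sum => m _.
rewrite normrM ler_piMr//; have := mono_le (fun i => m i) x.
by rewrite x1 expr1n.
Qed.

Lemma continuous_within_meval (A : set R) (gam : R -> pt R n) p :
  (forall i, {within A, continuous (fun u => gam u i)}) ->
  {within A, continuous (fun u => meval (gam u) p)}.
Proof.
move=> cg; elim/mpoly_ring_ind: p => [c|i|p q cp cq|p q cp cq].
- by rewrite (_ : (fun u => _) = cst c); [move=> x; exact: cvg_cst|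
    apply/funext => u; rewrite mevalC].
- by rewrite (_ : (fun u => _) = (fun u => gam u i)) //; apply/funext => u; rewrite mevalXU.
- rewrite (_ : (fun u => _) = (fun u => meval (gam u) p + meval (gam u) q)); last first.
    by apply/funext => u; rewrite mevalD.
  by move=> x; apply: (continuousD (cp x) (cq x)).
- rewrite (_ : (fun u => _) = (fun u => meval (gam u) p * meval (gam u) q)); last first.
    by apply/funext => u; rewrite mevalM.
  exact: continuous_withinM.
Qed.

(** For [l = <e, .>] the recursion reads: [d + j + 1] times the mean of [l^(j+2)] is [j + 1] times
    the mean of [l^j]. For [j = 2 k] the quotient [(2k+1)/(d+2k+1)] is at least [1/(d+1)]. *)
Lemma smean_lform_exp (e : pt R n) k : (0 < d)%N -> enorm e = 1 ->
  (n%:R ^+ k)^-1 <= smean (lform e ^+ (2 * k)).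
Proof.
move=> d0 e1; set l := lform e.
have dl : degin 1 1 l.
  apply: degin_sum => i _; apply: deginZ.
  by have := @deginX R d (mnm1 i); rewrite mdeg1.
have dX i j : mderiv i (l ^+ j.+1) = (j.+1%:R * e i) *: l ^+ j.
  elim: j => [|j IH]; first by rewrite expr1 mul1r mderiv_lform -mul_mpolyC mulr1.
  rewrite exprS mderivM IH mderiv_lform mul_mpolyC -[l * _]scalerAr -exprS -scalerDl.
  by congr (_ *: _); rewrite -[j.+2%:R]natr1; ring.
have rec j : (d + j.+1)%:R * smean (l ^+ j.+2) = j.+1%:R * smean (l ^+ j).
  rewrite [l ^+ j.+2]exprS {1}/l /lform mulr_suml linear_sum/= mulr_sumr.
  transitivity (\sum_i e i ^+ 2 * (j.+1%:R * smean (l ^+ j))).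
    apply: eq_bigr => i _; rewrite -scalerAl smeanZ mulrCA (smean_stein i (@degin_exp R d l j.+1 dl)).
    by rewrite dX smeanZ; ring.
  by rewrite -mulr_suml sphere_sqr_sum// mul1r.
elim: k => [|k IH]; first by rewrite muln0 !expr0 invr1 smean1.
have -> : (2 * k.+1 = (2 * k).+2)%N by lia.
have D0 : (0 : R) < (d + (2 * k).+1)%:R by rewrite ltr0n; lia.
rewrite -(ler_pM2l D0) rec exprS invfM.
have n0 : (0 : R) < n%:R by rewrite ltr0n.
apply: le_trans (ler_wpM2l _ IH); last by rewrite ler0n.
rewrite mulrA ler_wpM2r ?invr_ge0 ?exprn_ge0//.
by rewrite ler_pdivrMr// -natrM ler_nat; nia.
Qed.

Lemma exists_orthogonal_unit (x : pt R n) : (0 < d)%N ->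
  exists e : pt R n, enorm e = 1 /\ dot e x = 0.
Proof.
move=> d0; have i1 : (1 < n)%N by [].
have dE s c : dot (planar s c) x = s * x ord0 + c * x (Ordinal i1).
  rewrite /dot (bigD1 ord0)//= (bigD1 (Ordinal i1))//= [Y in _ + (_ + Y)]big1 ?addr0// => i.
  by case: i => -[|[|i]] //= *; rewrite /planar/= mul0r.
set a := x ord0 in dE; set b := x (Ordinal i1) in dE.
have r0 : 0 <= a ^+ 2 + b ^+ 2 by rewrite addr_ge0 ?sqr_ge0.
have [ab|ab] := eqVneq (a ^+ 2 + b ^+ 2) 0.
  exists (planar 1 0); rewrite enorm_planar ?dE//; last by ring.
  split=> //; have : a ^+ 2 = 0 by have := sqr_ge0 a; have := sqr_ge0 b; lra.
  by move=> /eqP; rewrite sqrf_eq0 => /eqP ->; ring.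
set r := Num.sqrt (a ^+ 2 + b ^+ 2).
have rr : r ^+ 2 = a ^+ 2 + b ^+ 2 by rewrite sqr_sqrtr.
have rn : r != 0 by apply: contraNneq ab => re; rewrite -rr re expr0n.
exists (planar (b / r) (- a / r)); rewrite dE; split; last by field.
by apply: (enorm_planar d0); rewrite !expr_div_n sqrrN -mulrDl rr addrC divff.
Qed.

End PolynomialsOnSphere.

(** * The weighted mean along the curve *)

Section CurveFunctional.
Variables (R : realType) (d t : nat) (gam : R -> pt R d.+1) (L : R) (w : pt R d.+1 -> R) (a A : R).
Hypothesis hMZ : wMZ_curve t gam L w a A.
Local Notation n := d.+1.
Local Notation mp := (mpoly n R).
Local Notation smean := (@smean R d).
Local Notation mu := (@lebesgue_measure R).
Local Notation IL := (`[(0 : R), L]%classic).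
Implicit Types (p q : mp).

Definition cmean p : R := L^-1 * Rintegral mu IL (fun u => meval (gam u) p * w (gam u)).

Lemma curve_length_gt0 : 0 < L.
Proof. by case: hMZ => -[]. Qed.

Lemma curve_unit u : 0 <= u <= L -> enorm (gam u) = 1.
Proof. by case: hMZ => -[_ [h _]] _ uL; apply: h; rewrite in_itv. Qed.

Lemma integrable_meval_w p :
  mu.-integrable IL (EFin \o (fun u => meval (gam u) p * w (gam u))).
Proof.
case: hMZ => -[_ [gn [_ [cg _]]]] [_ [iw _]].
have [B B0 hB] := meval_bounded p.
have mg : measurable_fun (IL : set (measurableTypeR R))
    (fun u : measurableTypeR R => meval (gam u) p).
  by apply: subspace_continuous_measurable_fun => //; exact: continuous_within_meval.
have bg : [bounded meval (gam u) p | u in IL].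
  exists B; split; first exact: num_real.
  move=> M BM u uL; apply: (le_trans _ (ltW BM)); apply: hB; exact: gn.
have := integrableMr _ mg bg iw; apply => //.
Qed.

Lemma cmeanD p q : cmean (p + q) = cmean p + cmean q.
Proof.
rewrite /cmean -mulrDr -RintegralD//; try exact: integrable_meval_w.
by congr (_ * _); apply: eq_Rintegral => u _; rewrite mevalD mulrDl.
Qed.

Lemma cmeanZ c p : cmean (c *: p) = c * cmean p.
Proof.
have e : Rintegral mu IL (fun u => meval (gam u) (c *: p) * w (gam u)) =
    c * Rintegral mu IL (fun u => meval (gam u) p * w (gam u)).
  rewrite -RintegralZl//; last exact: integrable_meval_w.
  by apply: eq_Rintegral => u _; rewrite mevalZ mulrA.
by rewrite /cmean e mulrCA.
Qed.

Lemma cmean_sum (J : Type) (r : seq J) (F : J -> mp) :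
  cmean (\sum_(j <- r) F j) = \sum_(j <- r) cmean (F j).
Proof.
by apply: (big_morph _ cmeanD); rewrite -(scale0r (0 : mp)) cmeanZ mul0r.
Qed.

Lemma le_cmean p q : (forall u, 0 <= u <= L -> meval (gam u) p <= meval (gam u) q) ->
  cmean p <= cmean q.
Proof.
move=> pq; rewrite /cmean ler_wpM2l ?invr_ge0 ?(ltW curve_length_gt0)//.
apply: le_Rintegral => //; try exact: integrable_meval_w.
move=> u uL; rewrite ler_wpM2r//; last by apply: pq; move: uL; rewrite /= in_itv.
by case: hMZ => _ [w0 _]; exact: w0.
Qed.

Lemma cmean_bounds p : degin 0 t p ->
  a * smean (p * p) <= cmean (p * p) /\ cmean (p * p) <= A * smean (p * p).
Proof.
move=> dp; case: hMZ => _ [_ [_ h]]; have := h _ (in_Pi_meval dp).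
rewrite L2sq_meval /curve_int /cmean.
under [in X in (_ <= _ * X /\ _) -> _]eq_Rintegral do rewrite expr2 -mevalM.
by under [in X in (_ /\ _ * X <= _) -> _]eq_Rintegral do rewrite expr2 -mevalM.
Qed.

Lemma cmean1_bounds : a <= cmean 1 /\ cmean 1 <= A.
Proof.
have d1 : degin 0 t (1 : mp) by apply: deginW (@degin1 R d).
by have := cmean_bounds d1; rewrite mulr1 smean1 !mulr1.
Qed.

Lemma midpoint_cover (m : nat) u : (0 < m)%N -> 0 <= u <= L ->
  exists j : 'I_m, `|(2 * j%:R + 1) * (L / (2 * m%:R)) - u| <= L / (2 * m%:R).
Proof.
case: m => // m _ /andP[u0 uL].
have mp0 : (0 : R) < m.+1%:R by rewrite ltr0n.
set h := L / _.
have hL : L = 2 * m.+1%:R * h by rewrite /h; field; rewrite gt_eqF.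
have h0 : 0 < h by rewrite /h divr_gt0 ?curve_length_gt0// mulr_gt0.
have h20 : 0 < 2 * h by rewrite mulr_gt0.
(* The sample parameters are the centres of equal arcs of half-length [h], and rounding down
   [u / (2 h)] finds the arc. At [u = L] this index would be one too large, so the last arc is
   taken. *)
have [uLt|uge] := ltP u L; last first.
  exists ord_max; have -> : u = L by apply/eqP; rewrite eq_le uL uge.
  rewrite {1}hL -natr1 /= ler_norml; apply/andP; split; lra.
have q0 : 0 <= u / (2 * h) by rewrite divr_ge0// ltW.
have /andP[k1 k2] := truncn_itv q0; set k := Num.truncn _ in k1 k2.
have km : (k < m.+1)%N.
  rewrite -(ltr_nat R); apply: (le_lt_trans k1); rewrite ltr_pdivrMr//.
  by move: uLt; rewrite {1}hL; lra.
exists (Ordinal km) => /=.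
move: k1 k2; rewrite ler_pdivlMr// ltr_pdivrMr// -natr1 ler_norml => k1 k2.
by apply/andP; split; lra.
Qed.

End CurveFunctional.

(** * The length estimate *)

Section MZBounds.
Variables (R : realType) (d t : nat) (gam : R -> pt R d.+1) (L : R) (w : pt R d.+1 -> R) (a A : R).
Hypothesis d0 : (0 < d)%N.
Hypothesis hMZ : wMZ_curve t gam L w a A.
Local Notation n := d.+1.
Local Notation mp := (mpoly n R).
Local Notation N := (dimPi d t).
Local Notation cmean := (@cmean R d gam L w).

(** The sum of the squares [K_j^2] has curve mean at most [m A N], because the mean square of [K_x]
    is [K(x,x) = N]. At each curve point the nearest sample alone contributes at least [c^2], and
    the constant 1 has curve mean at least [a]. One factor [N] then cancels. *)
Lemma length_sampling_bound (m : nat) : (d <= t)%N -> (0 < m)%N ->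
  t%:R ^+ 2 / d%:R * (L / (2 * m%:R)) ^+ 2 <= 1 ->
  a * N%:R * (1 - t%:R ^+ 2 / d%:R * (L / (2 * m%:R)) ^+ 2) ^+ 2 <= A * m%:R.
Proof.
move=> htd m0; have t0 := leq_trans d0 htd; set T := t%:R ^+ 2 / d%:R; set h := L / _ => Th.
have Np : (0 : R) < N%:R by rewrite ltr0n dimPi_gt0.
have Tp : 0 <= T by rewrite divr_ge0// sqr_ge0.
have L0 := curve_length_gt0 hMZ.
have mp0 : (0 : R) < m%:R by rewrite ltr0n.
have hL : L = 2 * m%:R * h by rewrite /h; field; rewrite gt_eqF.
have h0 : 0 <= h by rewrite divr_ge0 ?(ltW L0)// mulr_ge0.
pose v (j : 'I_m) := (2 * j%:R + 1) * h.
have vL j : 0 <= v j <= L.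
  apply/andP; split; first by rewrite /v mulr_ge0// addr_ge0// mulr_ge0.
  rewrite [leRHS]hL /v; apply: ler_wpM2r => //; have : j.+1%:R <= m%:R :> R by rewrite ler_nat.
  by rewrite -natr1; lra.
pose K j : mp := kpoly t (gam (v j)).
have up j : cmean (K j * K j) <= A * N%:R.
  have dK : degin 0 t (K j) by apply: deginW (inV_kpoly t0 (x := gam (v j))).
  have [_] := cmean_bounds hMZ dK.
  by rewrite -kerE// ker_diag// (curve_unit hMZ).
set c := N%:R * (1 - T * h ^+ 2).
(* The assumption on [m] enters here: the pointwise bound [c <= K_j] may be squared only for
   nonnegative [c]. *)
have c0 : 0 <= c by rewrite mulr_ge0 ?subr_ge0// ltW.
have low : cmean (c ^+ 2 *: 1) <= cmean (\sum_j K j * K j).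
  apply: (le_cmean hMZ) => u uL; rewrite mevalZ meval1 mulr1 raddf_sum/=.
  have [j hj] := midpoint_cover hMZ m0 uL; rewrite -/h -/(v j) in hj.
  rewrite (bigD1 j)//= mevalM -expr2.
  apply: (@le_trans _ _ (meval (gam u) (K j) ^+ 2)); last first.
    by rewrite lerDl; apply: sumr_ge0 => i _; rewrite mevalM -expr2 sqr_ge0.
  have cK : c <= meval (gam u) (K j).
    have := ker_curve d0 htd (proj1 hMZ) (vL j) uL; apply: le_trans.
    rewrite /c ler_pM2l// lerD2l lerN2 ler_wpM2l//.
    by rewrite -[leLHS]sqrrN opprB -[leLHS]real_normK ?num_real// lerXn2r ?nnegrE.
  by rewrite lerXn2r ?nnegrE// (le_trans c0).
rewrite (cmeanZ hMZ) (cmean_sum hMZ) in low.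
have s : \sum_j cmean (K j * K j) <= m%:R * (A * N%:R).
  rewrite -[m in leRHS]card_ord mulr_natl -sumr_const; apply: ler_sum => j _; exact: up.
have [J1 _] := cmean1_bounds hMZ.
have := ler_wpM2l (sqr_ge0 c) J1 => J2.
have : c ^+ 2 * a <= m%:R * (A * N%:R) by lra.
have -> : c ^+ 2 * a = N%:R * (a * N%:R * (1 - T * h ^+ 2) ^+ 2) by rewrite /c; ring.
have -> : m%:R * (A * N%:R) = N%:R * (A * m%:R) by ring.
by rewrite ler_pM2l.
Qed.

Lemma length_diameter_bound : 0 < a -> a / n%:R ^+ t <= A * (L / 2) ^+ (2 * t).
Proof.
move=> ha; have L0 := curve_length_gt0 hMZ.
have mL : 0 <= L / 2 <= L by apply/andP; split; lra.
have [e [e1 ex]] := exists_orthogonal_unit (gam (L / 2)) d0.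
have dl : degin 0 t (lform e ^+ t).
  apply: (@deginW R d t t) => //; apply: degin_exp.
  apply: degin_sum => i _; apply: deginZ.
  by have := @deginX R d (mnm1 i); rewrite mdeg1.
have [lo _] := cmean_bounds hMZ dl; have [_ J1] := cmean1_bounds hMZ.
have im := smean_lform_exp t d0 e1; rewrite mul2n -addnn exprD in im.
have up : cmean (lform e ^+ t * lform e ^+ t) <= cmean ((L / 2) ^+ (2 * t) *: 1).
  apply: (le_cmean hMZ) => u uL; rewrite mevalZ meval1 mulr1 -exprD addnn -mul2n !exprM.
  rewrite rmorphXn/= rmorphXn/= meval_lform lerXn2r ?nnegrE ?sqr_ge0//.
  (* As [e] is orthogonal to the midpoint, the form sees only the chord from it, and no point is
     further than [L / 2] from the midpoint along the curve. *)
  have -> : dot e (gam u) = dot e (fun i => gam u i - 1 * gam (L / 2) i).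
    by rewrite dotBZr ex mulr0 subr0.
  apply: (le_trans (dot_cauchy_schwarz _ _)); rewrite dotxx e1 expr1n mul1r.
  set q := dot _ _.
  have qE : q = \sum_i (gam u i - gam (L / 2) i) ^+ 2.
    by apply: eq_bigr => i _; rewrite mul1r expr2.
  rewrite qE; case/andP: uL => u0 uL; have [uh|/ltW uh] := leP u (L / 2).
    have := curve_chord (proj1 hMZ) u0 uh (andP mL).2.
    under eq_bigr do rewrite -sqrrN opprB.
    move=> h; apply: (le_trans h); rewrite ler_sqr ?nnegrE; lra.
  have := curve_chord (proj1 hMZ) (andP mL).1 uh uL.
  move=> h; apply: (le_trans h); rewrite ler_sqr ?nnegrE; lra.
rewrite (cmeanZ hMZ) in up.
have p0 : 0 <= (L / 2) ^+ (2 * t) by rewrite exprn_ge0//; lra.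
apply: (le_trans (ler_wpM2l (ltW ha) im)); apply: (le_trans lo); apply: (le_trans up).
by rewrite [leRHS]mulrC ler_wpM2l.
Qed.

End MZBounds.

Theorem theorem5p2 (R : realType) (d t : nat) (hdt : (2 <= d)%N) (htd : (d <= t)%N)
    (gam : R -> pt R d.+1) (L : R) (w : pt R d.+1 -> R) (a A : R)
    (ha : 0 < a) (haA : a <= A) (hMZ : wMZ_curve t gam L w a A) :
  (dimPi d t)%:R / t%:R * (Num.sqrt (d%:R + 2) / 4)
    * powR (a / A) (1 + (2 * t%:R)^-1) <= L.
Proof.
have d0 : (0 < d)%N by lia.
have L0 := curve_length_gt0 hMZ.
have samp m := length_sampling_bound d0 hMZ (m := m) htd.
have diam := length_diameter_bound d0 hMZ ha.
have A0 : 0 < A by exact: lt_le_trans ha haA.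
have dp : (2 : R) <= d%:R by rewrite ler_nat.
have dt : d%:R <= t%:R :> R by rewrite ler_nat.
have tp : (0 : R) < t%:R by lra.
have Np : (0 : R) < (dimPi d t)%:R by rewrite ltr0n dimPi_gt0.
set N := (dimPi d t)%:R in samp Np *.
set th := a / A; have th0 : 0 < th by rewrite divr_gt0.
have th1 : th <= 1 by rewrite ler_pdivrMr// mul1r.
have aE : a = th * A by rewrite /th divfK// gt_eqF.
set rho := powR th (2 * t%:R)^-1.
have rho0 : 0 <= rho by exact: powR_ge0.
have rho1 : rho <= 1.
  rewrite -(powRr0 th); apply: ger_powR; first by rewrite th0.
  by rewrite invr_ge0 mulr_ge0// ltW.
rewrite powRD; last by rewrite gt_eqF ?implybT.
rewrite powRr1 ?(ltW th0)// -/rho.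
set sq := Num.sqrt (d%:R + 2); have sq0 : 0 <= sq by exact: sqrtr_ge0.
have sqE : sq ^+ 2 = d%:R + 2 by rewrite sqr_sqrtr//; lra.
set sd := Num.sqrt (d%:R : R).
have sdE : sd ^+ 2 = d%:R by rewrite sqr_sqrtr//; lra.
have sd0 : 0 < sd by rewrite sqrtr_gt0; lra.
(* The quantity [z] of one sample point; [m] points give [y / m]. *)
set y := t%:R * L / (2 * sd).
have y0 : 0 < y by rewrite divr_gt0 ?mulr_gt0.
have LE : L = 2 * y * sd / t%:R by rewrite /y; field; rewrite !gt_eqF.
have sampE (m : nat) : (0 < m)%N -> y / m%:R <= 1 ->
    th * N * (1 - (y / m%:R) ^+ 2) ^+ 2 <= m%:R.
  move=> m0 ym; have mp0 : (0 : R) < m%:R by rewrite ltr0n.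
  have e : t%:R ^+ 2 / d%:R * (L / (2 * m%:R)) ^+ 2 = (y / m%:R) ^+ 2.
    by rewrite LE -sdE; field; rewrite !gt_eqF.
  have ym0 : 0 <= y / m%:R by rewrite divr_ge0// ltW.
  have := samp m m0; rewrite e expr_le1// => /(_ ym).
  by rewrite aE (_ : th * A * N * _ = A * (th * N * (1 - (y / m%:R) ^+ 2) ^+ 2));
    [rewrite ler_pM2l|ring].
(* [(d+2)/d <= 2 < (36/25)^2] because [d >= 2]. The value [36/25] is [8 * 18/100], which is exactly
   what the long case affords. *)
have sqsd : sq <= 36 / 25 * sd.
  have : sq ^+ 2 <= (36 / 25 * sd) ^+ 2 by rewrite exprMn sqE sdE; lra.
  by rewrite ler_sqr// nnegrE; lra.
have thN0 : 0 < th * N by rewrite mulr_gt0.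
suff main : th * N * rho * sq <= 4 * t%:R * L.
  rewrite (_ : N / t%:R * (sq / 4) * (th * rho) = th * N * rho * sq / (4 * t%:R)).
    by rewrite ler_pdivrMr ?mulr_gt0// [leRHS]mulrC.
  by field; rewrite gt_eqF.
have tLE : 4 * t%:R * L = 8 * y * sd by rewrite LE; field; rewrite gt_eqF.
have [y3|y3] := leP (3 / 10) y.
  (* Take [m] one above the integer part of [y / 0.6]. Then [y / m < 0.6], and passing from [k >= 1]
     to [k + 1] at most halves the quotient, hence the lower end [0.3]; for [k = 0] it is the case
     assumption. *)
  have [m m0 [z1 z2]] : exists2 m : nat, (0 < m)%N & 3 / 10 <= y / m%:R /\ y / m%:R <= 6 / 10.
    have q0 : 0 <= y / (6 / 10) by rewrite divr_ge0// ltW.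
    have /andP[k1 k2] := truncn_itv q0; set k := Num.truncn _ in k1 k2.
    have kp0 : (0 : R) < k.+1%:R by rewrite ltr0n.
    exists k.+1 => //; rewrite ler_pdivlMr// ler_pdivrMr//.
    move: k1 k2; rewrite ler_pdivlMr// ltr_pdivrMr// -natr1 => k1 k2; split; last lra.
    case: (k) k1 => [|k']; first by move=> _; lra.
    by rewrite -natr1; have : (0 : R) <= k'%:R by []; lra.
  have mp0 : (0 : R) < m%:R by rewrite ltr0n.
  set z := y / m%:R in z1 z2 *.
  have yE : y = z * m%:R by rewrite /z divfK// gt_eqF.
  have z11 : z <= 1 by lra.
  have := sampE m m0 z11; rewrite -/z => sm.
  (* Multiplying the smallest [z] by the smallest [(1 - z^2)^2] is too lossy on the whole interval;
     cut at [0.45], it exceeds [0.18] on both halves. *)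
  have g : 18 / 100 <= z * (1 - z ^+ 2) ^+ 2.
    have [zm|zm] := leP z (45 / 100).
      have q : 79 / 100 <= 1 - z ^+ 2 by nra.
      have : (79 / 100) ^+ 2 <= (1 - z ^+ 2) ^+ 2 by rewrite ler_sqr// nnegrE; lra.
      nra.
    have q : 64 / 100 <= 1 - z ^+ 2 by nra.
    have : (64 / 100) ^+ 2 <= (1 - z ^+ 2) ^+ 2 by rewrite ler_sqr// nnegrE; lra.
    nra.
  have s1 : th * N * (18 / 100) <= y.
    apply: (@le_trans _ _ (th * N * (z * (1 - z ^+ 2) ^+ 2))); first by rewrite ler_pM2l.
    rewrite yE mulrCA; rewrite ler_pM2l//; lra.
  have s2 : th * N * rho <= th * N by rewrite ler_piMr// ltW.
  have s3 : th * N * rho * sq <= th * N * (36 / 25 * sd).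
    by apply: ler_pM => //; rewrite mulr_ge0// ltW.
  have s4 : th * N * (18 / 100) * sd <= y * sd by rewrite ler_pM2r.
  rewrite tLE; lra.
(* Short curves: one sample point with [1 - y^2 >= 0.91], and [1 / 0.91^2 < 1.25]. *)
have s1 : th * N <= 125 / 100.
  have := sampE 1%N (leqnn _); rewrite divr1 => /(_ (ltac:(lra))) sm.
  have q : 91 / 100 <= 1 - y ^+ 2 by nra.
  have : (91 / 100) ^+ 2 <= (1 - y ^+ 2) ^+ 2 by rewrite ler_sqr// nnegrE; lra.
  nra.
have sn0 : (0 : R) < Num.sqrt (d.+1)%:R by rewrite sqrtr_gt0 ltr0n.
have snE : Num.sqrt (d.+1)%:R ^+ 2 = (d.+1)%:R :> R by rewrite sqr_sqrtr.
set sn := Num.sqrt _ in sn0 snE.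
(* The [2t]-th root of the diameter bound [th <= (L/2)^(2t) (d+1)^t]. *)
have s2 : rho <= L / 2 * sn.
  have b : th <= (L / 2 * sn) ^+ (2 * t).
    rewrite exprMn (exprM sn) snE.
    have n0 : (0 : R) < d.+1%:R ^+ t by rewrite exprn_gt0 ?ltr0n.
    rewrite -ler_pdivrMr//; move: diam; rewrite aE -mulrA mulrCA ler_pM2l//.
  have b0 : 0 <= L / 2 * sn by rewrite mulr_ge0 ?(ltW sn0)//; lra.
  have e : (2 * t)%:R = 2 * t%:R :> R by rewrite natrM.
  have -> : L / 2 * sn = powR ((L / 2 * sn) ^+ (2 * t)) (2 * t%:R)^-1.
    rewrite -powR_mulrn// e -powRrM divff ?powRr1// gt_eqF// mulr_gt0//.
  have r0 : 0 <= (2 * t%:R)^-1 :> R by rewrite invr_ge0 mulr_ge0// ltW.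
  by apply: (ge0_ler_powR r0 _ _ b); rewrite nnegrE ?exprn_ge0// ltW.
(* [(d+1)(d+2) <= 4 d^2] for [d >= 2]. The left side of [main] is thus at most [1.25 t L], well
   below [4 t L]. *)
have s3 : sq * sn <= 2 * t%:R.
  have : (sq * sn) ^+ 2 <= (2 * t%:R) ^+ 2 by rewrite !exprMn sqE snE -natr1; nra.
  by rewrite ler_sqr// nnegrE mulr_ge0// ltW.
have r1 : th * N * rho * sq <= 125 / 100 * rho * sq by do 2 rewrite ler_wpM2r//.
have r2 : rho * sq <= L / 2 * (2 * t%:R).
  have L2 : 0 <= L / 2 by lra.
  by have := ler_wpM2r sq0 s2; have := ler_wpM2l L2 s3; lra.
have : 0 < t%:R * L by rewrite mulr_gt0.
lra.
Qed.
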